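(* Let $p,q,K$ be positive integers with $q\le p$, let $\lambda\ge0$, and let $$\mathcal{W}(x,t)=\int_0^K\frac{\phi(u,x)\overline{\phi(u,t)}}{1+\lambda\mu(u)}\,du,\qquad x,t\in\mathbb{R},$$ be the asymptotic equivalent kernel for spline estimators on $\mathbb{R}$. Let $$P_{2p}(u)=\frac{\Pi_{2p+1}(u)}{(2p+1)!}+(-1)^q\lambda K^{2q}(1-u)^{2q}\frac{\Pi_{2p-2q+1}(u)}{(2p-2q+1)!}$$ be a polynomial of degree $2p$, where $\Pi_j$ is the Euler--Frobenius polynomial. Let $r_j,r_j^{-1}$, $j=1,\ldots,p$, be the roots of $P_{2p}(u)$ with $|r_j|<1$. Denote $P_{2p}'(r_j)=\partial P_{2p}(u)/\partial u|_{u=r_j}$ and $$d_{x,t}=\big\lfloor Kx-\{(p+1)/2\}\big\rfloor-\big\lfloor Kt-\{(p+1)/2\}\big\rfloor ,$$ where $\{\cdot\}$ denotes the fractional part, and represent $$z^{p-d_{x,t}}\,\Phi_p\big(Kx+(p+1)/2,z\big)\,\Phi_p\big(Kt+(p+1)/2,z^{-1}\big)=\sum_{l=0}^{2p}\alpha_l(\{Kx\},\{Kt\})\,z^l$$ for some functions $\alpha_l(t_1,t_2)$. Then for all $x,t\in\mathbb{R}$ $$\mathcal{W}(x,t)=K\sum_{j=1}^p\sum_{l=0}^{2p}\frac{\alpha_l(\{Kx\},\{Kt\})}{P_{2p}'(r_j)}\;r_j^{\,|d_{x,t}+l-1|+(2p-2)\mathbb{I}(d_{x,t}+l\le0)},$$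 where $\mathbb{I}(A)$ equals $1$ if $A$ is true and $0$ otherwise.
   Context: $\mathrm{i}=(-1)^{1/2}$; $\mathrm{sinc}(x)=\sin(x)/x$, $\mathrm{sinc}(0)=1$; $\lfloor t\rfloor$ is the largest integer not greater than $t$ and $\{t\}$ is the fractional part of $t$. Euler--Frobenius polynomials: $\Pi_0=1$ and $\Pi_j$ ($j\ge1$, degree $j-1$) are given by $\frac{z-1}{z-e^{s}}=\sum_{j\ge0}\frac{\Pi_j(z)}{(z-1)^j}\frac{s^j}{j!}$ (e.g. $\Pi_1=1$, $\Pi_2=z+1$, $\Pi_3=z^2+4z+1$). Exponential splines: for $t\in\mathbb{R}$, $z\ne0,1$, $$\Phi_p(t,z)=z^{\lfloor t\rfloor}(1-z^{-1})^p\sum_{j=0}^p\binom pj\frac{\{t\}^{p-j}\,\Pi_j(z)}{p!\,(z-1)^j}$$ (convention $0^0=1$), and $\Phi_p(t,1)=1$. For an integer $m\ge0$, $Q_m(z)=\sum_{l=-\infty}^\infty \mathrm{sinc}(\pi(z+l))^{m+2}$. For real $u,x$, $$\phi(u,x)=\frac{\Phi_p\big(Kx+(p+1)/2,\exp(-2\pi\mathrm{i}u/K)\big)}{Q_{2p}(u/K)^{1/2}},\qquad \mu(u)=(2\pi u)^{2q}\,\mathrm{sinc}(\pi u/K)^{2q}\,\frac{Q_{2p-2q}(u/K)}{Q_{2p}(u/K)} .$$ Here $p$ is the spline degree, $K$ the number of knot intervals, $\lambda$ the smoothing parameter and $q$ the order of the derivative in the penalty.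
   Formalization: The formal theorem also assumes P_{2p}'(r_j) ≠ 0 for every j (simple roots); without it the quotients in the formula are undefined, e.g. for p=q=2 and λK^4=7/960, where P_4 has double roots. *)

(* Defs.v *)
From HB Require Import structures.
From mathcomp Require Import all_boot all_order all_algebra.
From mathcomp Require Import all_classical all_reals all_analysis.
From mathcomp.real_closed Require Import complex.

Set Implicit Arguments.
Unset Strict Implicit.
Unset Printing Implicit Defensive.

Import Order.TTheory GRing.Theory Num.Theory.
Import numFieldNormedType.Exports.

Local Open Scope classical_set_scope.
Local Open Scope ring_scope.

Section Definitions.
Context {R : realType}.
Local Notation C := R[i].

Definition sinc (x : R) : R := if x == 0 then 1 else sin x / x.

Definition frac_part (t : R) : R := t - (Num.floor t)%:~R.

Definition cis (a : R) : C := Complex (cos a) (sin a).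

(* The generating function is read as a convergent expansion, for s close to
   0, at every real point z <> 1; since polynomials are determined by their
   values at these points, there is exactly one such family Pi. *)
Definition euler_frobenius (Pi : nat -> {poly R}) : Prop :=
  [/\ Pi 0%N = 1,
      (forall j : nat, (0 < j)%N -> size (Pi j) = j) &
      (forall z : R, z != 1 -> \forall s \near (0 : R),
         series (fun j : nat => (Pi j).[z] / (z - 1) ^+ j * (s ^+ j / j`!%:R))
           @ \oo --> (z - 1) / (z - expR s))].

Definition polyC_of (P : {poly R}) : {poly C} := map_poly (real_complex R) P.

(* Meaningful for z <> 0. *)
Definition Phi (Pi : nat -> {poly R}) (p : nat) (t : R) (z : C) : C :=
  if z == 1 then 1 else
    z ^ (Num.floor t) * (1 - z^-1) ^+ p *
    \sum_(j < p.+1)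
      'C(p, j)%:R * (real_complex R (frac_part t) ^+ (p - j)
                       * (polyC_of (Pi j)).[z] / (p`!%:R * (z - 1) ^+ j)).

(* The two-sided sum is split into the indices l >= 0 and l <= -1. *)
Definition Q (m : nat) (z : R) : R :=
  limn (series (fun l : nat => sinc (pi * (z + l%:R)) ^+ (m + 2))) +
  limn (series (fun l : nat => sinc (pi * (z - l.+1%:R)) ^+ (m + 2))).

Definition phi (Pi : nat -> {poly R}) (p K : nat) (u x : R) : C :=
  Phi Pi p (K%:R * x + (p.+1)%:R / 2) (cis (- (2 * pi * u / K%:R)))
  / real_complex R (Num.sqrt (Q (2 * p) (u / K%:R))).

Definition mu (p q K : nat) (u : R) : R :=
  (2 * pi * u) ^+ (2 * q) * sinc (pi * u / K%:R) ^+ (2 * q) *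
  (Q (2 * p - 2 * q) (u / K%:R) / Q (2 * p) (u / K%:R)).

Definition Cintegral (D : set R) (f : R -> C) : C :=
  Complex (\int[lebesgue_measure]_(u in D) complex.Re (f u))
          (\int[lebesgue_measure]_(u in D) complex.Im (f u)).

Definition W (Pi : nat -> {poly R}) (p q K : nat) (lambda x t : R) : C :=
  Cintegral `[0, K%:R] (fun u =>
    phi Pi p K u x * conjc (phi Pi p K u t)
    / real_complex R (1 + lambda * mu p q K u)).

Definition P2p (Pi : nat -> {poly R}) (p q K : nat) (lambda : R) : {poly C} :=
  polyC_of
    ((((2 * p).+1)`!%:R)^-1 *: Pi (2 * p).+1 +
     ((-1) ^+ q * lambda * K%:R ^+ (2 * q) / ((2 * p - 2 * q).+1)`!%:R) *:
       ((1 - 'X) ^+ (2 * q) * Pi (2 * p - 2 * q).+1)).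

Definition dxt (p K : nat) (x t : R) : int :=
  Num.floor (K%:R * x - frac_part ((p.+1)%:R / 2)) -
  Num.floor (K%:R * t - frac_part ((p.+1)%:R / 2)).

Definition represents (Pi : nat -> {poly R}) (p K : nat)
    (alpha : 'I_(2 * p).+1 -> R -> R -> C) : Prop :=
  forall (x t : R) (z : C), z != 0 ->
    z ^ (p%:Z - dxt p K x t)
      * Phi Pi p (K%:R * x + (p.+1)%:R / 2) z
      * Phi Pi p (K%:R * t + (p.+1)%:R / 2) z^-1
    = \sum_(l < (2 * p).+1)
        alpha l (frac_part (K%:R * x)) (frac_part (K%:R * t)) * z ^+ l.

End Definitions.

(* Main.v *)
(** On the circle z = exp(-2 i pi u / K) the integrand of W is
    z^d (sum_l alpha_l z^l) / P_2p(z): this follows from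
    Q_2k(v) = z^-k Pi_(2k+1)(z) / (2k+1)! with z = exp(-2 i pi v).  Both sides
    of that identity satisfy the two-scale relation
    f(v) = cos(pi v/2)^(2k+2) f(v/2) + sin(pi v/2)^(2k+2) f((v+1)/2)
    and differ from 1 by O(sin(pi v)); the relation contracts such
    differences by the factor 3/4, so they coincide.  For Q_2k the relation
    splits the series into even and odd indices using
    sinc(2y) = cos(y) sinc(y); for Pi it reflects
    2w / (w^2 - e^(2s)) = 1 / (w - e^s) + 1 / (w + e^s).  The integral is then
    computed by partial fractions: J_k = int z^k / (z - rho) satisfies
    J_(k+1) = rho J_k + K [k = 0] and is bounded in k in both directions,
    which determines it when |rho| <> 1. *)

Require Import Defs.
From HB Require Import structures.
From mathcomp Require Import all_boot all_order all_algebra.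
From mathcomp Require Import all_classical all_reals all_analysis.
From mathcomp.real_closed Require Import complex.
From mathcomp Require Import ring lra zify.

Set Implicit Arguments.
Unset Strict Implicit.
Unset Printing Implicit Defensive.

Import Order.TTheory GRing.Theory Num.Theory.
Import numFieldNormedType.Exports.

Local Open Scope classical_set_scope.
Local Open Scope ring_scope.

(** * Euler-Frobenius polynomials *)

(** The weight sin(pi v) in the contraction is forced: at v = 0 the two-scale relation only says
    f(0) = f(0), so it contracts nothing in the plain sup norm. With c and s the cosine and sine of
    pi v / 2, the weights at v/2 and (v+1)/2 are s and c, and c^(2k+2) s + s^(2k+2) c <= c s (c + s)
    <= (3/2) c s = (3/4) sin(pi v), because c + s <= sqrt 2 < 3/2. A second obstacle is that Pi is
    known only through real expansions near s = 0, while z runs over the unit circle. Facts about Pi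
    are therefore obtained as identities between real polynomials: expansions are truncated with an
    O(s^N) remainder, coefficients are compared at each integer point >= 2, and the resulting
    polynomial identity is mapped to the complex numbers. In the final sum each power z^k meets the
    poles r_j and 1/r_j, of which exactly one contributes: the inner one for k >= 1, the outer one
    for k <= 0. This is the origin of the indicator in the exponent. *)

Lemma series_taylor (R : realType) (a : nat -> R) (f : R -> R) (n : nat) :
  (\forall s \near (0 : R), series (fun j => a j * s ^+ j) @ \oo --> f s) ->
  exists M, \forall s \near (0 : R),
    `|f s - \sum_(j < n) a j * s ^+ j| <= M * `|s| ^+ n.
Proof.
move=> /nbhs_ballP[e /= e0 He].
pose s0 : R := e / 2.
have s00 : 0 < s0 by rewrite divr_gt0.
have s0e : s0 < e by rewrite /s0; lra.
clearbody s0.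
have /He cs0 : ball (0 : R) e s0.
  by rewrite /ball /= sub0r normrN gtr0_norm.
(* Convergence at the single point [s0] bounds the terms there; for |s| <= s0/2 the ratio [t] =
   |s|/s0 <= 1/2 gives the majorant B t^j, whose tail from [n] on is at most 2 B t^n. *)
have [B [B0 HB]] : exists B, 0 < B /\ forall j, `|a j * s0 ^+ j| <= B.
  have : bounded_fun (fun j => a j * s0 ^+ j).
    by apply: cvg_series_bounded; apply/cvg_ex; eexists; exact: cs0.
  move=> [M [_ HM]]; exists (`|M| + 1); split; first by rewrite ltr_pwDr.
  by move=> j; apply: HM => //; rewrite (le_lt_trans (ler_norm M))// ltrDl.
exists (2 * B / s0 ^+ n).
apply/nbhs_ballP; exists (s0 / 2) => /=; first by rewrite divr_gt0.
move=> s; rewrite /ball /= sub0r normrN => hs.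
have /He cs : ball (0 : R) e s.
  rewrite /ball /= sub0r normrN; apply: lt_trans hs _; lra.
pose t : R := `|s| / s0.
have t0 : 0 <= t by rewrite divr_ge0// ltW.
have t1 : t <= 1 / 2 by rewrite ler_pdivrMr//; lra.
have term j : `|a j * s ^+ j| <= B * t ^+ j.
  rewrite normrM normrX.
  have -> : `|a j| * `|s| ^+ j = `|a j * s0 ^+ j| * t ^+ j.
    rewrite normrM normrX (gtr0_norm s00) -mulrA -exprMn /t mulrC [s0 * _]mulrC.
    by rewrite divfK ?gt_eqF// mulrC.
  by rewrite ler_wpM2r// exprn_ge0.
have part N : `|\sum_(n <= j < n + N) a j * s ^+ j| <=
    B * t ^+ n * (2 - 2 * (1 / 2) ^+ N).
  elim: N => [|N IH].
    by rewrite addn0 big_geq// normr0 expr0 mulr1 subrr mulr0.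
  rewrite addnS big_nat_recr ?leq_addr//=.
  apply: le_trans (ler_normD _ _) _; apply: le_trans (lerD IH (term _)) _.
  rewrite exprD mulrA -mulrDr ler_wpM2l ?(mulr_ge0 (ltW B0)) ?exprn_ge0//.
  have : t ^+ N <= (1 / 2) ^+ N by rewrite lerXn2r// nnegrE.
  by rewrite exprS; set x := (_ ^+ N); set y := (_ ^+ N); lra.
have cn : (fun N => `|series (fun j => a j * s ^+ j) N - \sum_(j < n) a j * s ^+ j|)
    @ \oo --> `|f s - \sum_(j < n) a j * s ^+ j|.
  by apply: cvg_norm; apply: cvgB => //; exact: cvg_cst.
rewrite -(cvg_lim _ cn)//; apply: limr_le; first by apply/cvg_ex; eexists; exact: cn.
exists n => // N /= nN.
rewrite /series /= -(big_mkord xpredT (fun j => a j * s ^+ j)).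
rewrite (big_cat_nat (leq0n n) nN)//= addrAC subrr add0r.
rewrite -(subnKC nN); apply: le_trans (part _) _.
have -> : 2 * B / s0 ^+ n * `|s| ^+ n = B * t ^+ n * 2.
  by rewrite /t expr_div_n; ring.
rewrite ler_wpM2l ?(mulr_ge0 (ltW B0)) ?exprn_ge0//.
by rewrite gerBl mulr_ge0// exprn_ge0.
Qed.

(** P(0) = 0 follows by letting s tend to 0, after which a factor X is divided out; this division by
    s is why the neighbourhood is punctured. *)
Lemma poly_bigO_coef (R : realType) (n : nat) (P : {poly R}) :
  (exists M, \forall s \near (0 : R)^', `|P.[s]| <= M * `|s| ^+ n) ->
  forall i, (i < n)%N -> P`_i = 0.
Proof.
elim: n P => [//|n IH] P [M HM].
have P0 : P.[0] = 0.
  apply/eqP; rewrite -normr_le0.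
  have c1 : `|P.[s]| @[s --> (0 : R)^'] --> `|P.[0]|.
    apply: cvg_norm; apply: cvg_trans (@continuous_horner R P 0).
    by apply: cvg_app; exact: nbhs_dnbhs.
  have c2 : M * `|s| ^+ n.+1 @[s --> (0 : R)^'] --> M * `|0 : R| ^+ n.+1.
    apply: cvgM; first exact: cvg_cst.
    apply: (@cvg_comp _ _ _ (fun s : R => `|s|) (fun x => x ^+ n.+1) _ (nbhs `|0 : R|)).
      by apply: cvg_norm => A hA; exact: (nbhs_dnbhs hA).
    exact: exprn_continuous.
  have c20 : M * `|0 : R| ^+ n.+1 = 0 by rewrite normr0 expr0n mulr0.
  by rewrite -[leRHS]c20; exact: (ler_cvg_to c1 c2 HM).
have /factor_theorem[Q] : root P 0 by apply/rootP.
rewrite subr0 => PE.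
have HQ : exists M, \forall s \near (0 : R)^', `|Q.[s]| <= M * `|s| ^+ n.
  exists M; near=> s.
  have s0 : 0 < `|s| by rewrite normr_gt0; near: s; exact: nbhs_dnbhs_neq.
  have : `|P.[s]| <= M * `|s| ^+ n.+1 by near: s.
  by rewrite PE hornerMX normrM exprSr mulrA ler_pM2r.
case=> [_|i ?]; first by rewrite -horner_coef0.
by rewrite PE coefMX/=; apply: IH.
Unshelve. all: by end_near. Qed.

Lemma near_bounded (R : realType) (g : R -> R) (x : R) :
  {for x, continuous g} -> exists B, 0 <= B /\ \forall s \near x, `|g s| <= B.
Proof.
move=> /cvgrPdist_lt /(_ 1 ltr01) H; exists (`|g x| + 1); split.
  by rewrite addr_ge0.
near=> s.
have h : `|g x - g s| < 1 by near: s.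
have -> : g s = g x - (g x - g s) by ring.
by rewrite (le_trans (ler_normB _ _))// lerD2l ltW.
Unshelve. all: by end_near. Qed.

(** The offset [m] is 2 in the applications, which keeps the evaluation points away from z = 1,
    where the generating function is not expanded. *)
Lemma poly_eq_nat (R : realType) (P Q : {poly R}) (m : nat) :
  (forall n : nat, P.[n%:R + m%:R] = Q.[n%:R + m%:R]) -> P = Q.
Proof.
move=> H; apply/eqP; rewrite -subr_eq0; apply/negPn/negP => PQ0.
have := @max_poly_roots _ _ [seq n%:R + m%:R | n : nat <- iota 0 (size (P - Q))] PQ0.
rewrite size_map size_iota ltnn => h; suff : false by []; apply: h.
  by apply/allP => _ /mapP[n _ ->]; rewrite /root hornerD hornerN H subrr.
rewrite map_inj_uniq ?iota_uniq// => i j /addIr /eqP.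
by rewrite eqr_nat => /eqP.
Qed.

Lemma expR_taylor (R : realType) (n : nat) :
  exists M, \forall s \near (0 : R),
    `|expR s - \sum_(j < n) j`!%:R^-1 * s ^+ j| <= M * `|s| ^+ n.
Proof.
apply: (@series_taylor R (fun j => j`!%:R^-1) expR n); near=> s.
by rewrite -exp_coeffE; exact: is_cvg_series_exp_coeff.
Unshelve. all: by end_near. Qed.

Lemma euler_frobenius_taylor (R : realType) (Pi : nat -> {poly R}) :
  euler_frobenius Pi -> forall (z : R) (n : nat), z != 1 ->
  exists M, \forall s \near (0 : R),
    `|(z - 1) / (z - expR s)
      - \sum_(j < n) ((Pi j).[z] / (z - 1) ^+ j / j`!%:R) * s ^+ j|
    <= M * `|s| ^+ n.
Proof.
move=> [_ _ H] z n z1.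
apply: (@series_taylor R (fun j => (Pi j).[z] / (z - 1) ^+ j / j`!%:R)
  (fun s => (z - 1) / (z - expR s)) n); near=> s.
have -> : (fun j => (Pi j).[z] / (z - 1) ^+ j / j`!%:R * s ^+ j) =
    (fun j => (Pi j).[z] / (z - 1) ^+ j * (s ^+ j / j`!%:R)).
  by apply/funext => j; rewrite mulrAC mulrA.
by near: s; exact: H.
Unshelve. all: by end_near. Qed.

Lemma near_expR_neq (R : realType) (z : R) : z != 1 ->
  \forall s \near (0 : R), z - expR s != 0.
Proof.
move=> z1; have : (fun s : R => z - expR s) s @[s --> (0:R)] --> z - expR 0.
  by apply: cvgB; [exact: cvg_cst | exact: continuous_expR].
rewrite expR0 => /cvgrPdist_lt /(_ `|z - 1|); rewrite normr_gt0 subr_eq0 => /(_ z1) h.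
near=> s; apply/eqP => zs.
suff : `|z - 1 - (z - expR s)| < `|z - 1| by rewrite zs subr0 ltxx.
by near: s.
Unshelve. all: by end_near.
Qed.

(** This is the coefficient of s^(n+1) in (z - e^s) sum_j a_j s^j = z - 1, where a_j = Pi_j(z) / ((z
    - 1)^j j!). *)
Lemma euler_frobenius_rec_horner (R : realType) (Pi : nat -> {poly R}) :
  euler_frobenius Pi -> forall (z : R) (n : nat), z != 1 ->
  (Pi n.+1).[z] =
    \sum_(k < n.+1) 'C(n.+1, k)%:R * ((Pi k).[z] * (z - 1) ^+ (n - k)).
Proof.
move=> hPi z n z1.
pose N := n.+2.
pose a j := (Pi j).[z] / (z - 1) ^+ j / j`!%:R.
pose Ta := \poly_(i < N) a i; pose Te : {poly R} := \poly_(i < N) (i`!%:R^-1).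
(* With both series truncated, [P] is a polynomial that is O(s^N), so its coefficient of index n + 1
   < N is zero. *)
pose P := (z%:P - Te) * Ta - (z - 1)%:P.
have [M1 H1] := euler_frobenius_taylor hPi N z1.
have [M2 H2] := @expR_taylor R N.
have [B1 [B10 HB1]] : exists B, 0 <= B /\ \forall s \near (0:R), `|z - expR s| <= B.
  apply: near_bounded; apply: cvgB; [exact: cvg_cst | exact: continuous_expR].
have [B2 [B20 HB2]] : exists B, 0 <= B /\ \forall s \near (0:R), `|Ta.[s]| <= B.
  apply: near_bounded; exact: continuous_horner.
have PO : exists M, \forall s \near (0 : R)^', `|P.[s]| <= M * `|s| ^+ N.
  exists (B1 * M1 + M2 * B2); near=> s.
  have nz : z - expR s != 0.
    by near: s; apply: nbhs_dnbhs; exact: near_expR_neq.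
  have -> : P.[s] = (z - expR s) * (Ta.[s] - (z - 1) / (z - expR s))
      + (expR s - Te.[s]) * Ta.[s].
    rewrite /P !hornerE mulrBr mulrCA divff// mulr1; ring.
  apply: le_trans (ler_normD _ _) _; rewrite [leRHS]mulrDl; apply: lerD.
    rewrite normrM -mulrA ler_pM// ?normr_ge0//; first by near: s; apply: nbhs_dnbhs.
    by rewrite distrC horner_poly; near: s; apply: nbhs_dnbhs.
  rewrite normrM mulrAC ler_pM// ?normr_ge0//.
    by rewrite horner_poly; near: s; apply: nbhs_dnbhs.
  by near: s; apply: nbhs_dnbhs.
have := poly_bigO_coef PO (ltnSn n.+1).
rewrite /P mulrBl !coefB coefCM coefC/= subr0 coefMr big_ord_recr/=.
rewrite subnn !coef_poly !ltnSn/= fact0 invr1 mul1r => E0.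
have E : (z - 1) * a n.+1 = \sum_(i < n.+1) Te`_(n.+1 - i) * Ta`_i.
  by move: E0; move: (a n.+1) (\sum_(i < _) _) => u v; lra.
have z10 : z - 1 != 0 by rewrite subr_eq0.
have nf0 (j : nat) : j`!%:R != 0 :> R by rewrite pnatr_eq0 -lt0n fact_gt0.
have -> : (Pi n.+1).[z] = (n.+1)`!%:R * (z - 1) ^+ n * ((z - 1) * a n.+1).
  rewrite /a exprS; field.
  by rewrite z10 nf0 expf_neq0.
rewrite E mulr_sumr; apply: eq_bigr => -[k /= kn] _.
have kn' : (k <= n.+1)%N by exact: ltnW.
rewrite !coef_poly !ltnS leq_subr kn' -(bin_fact kn').
rewrite /a !natrM -(subnK (_ : k <= n)%N)// exprD addnK; field.
by rewrite !nf0 expf_neq0.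
Unshelve. all: by end_near. Qed.

Lemma euler_frobenius_rec (R : realType) (Pi : nat -> {poly R}) :
  euler_frobenius Pi -> forall n : nat,
  Pi n.+1 = \sum_(k < n.+1) 'C(n.+1, k)%:R *: (Pi k * ('X - 1) ^+ (n - k)).
Proof.
move=> hPi n; apply: (@poly_eq_nat _ _ _ 2) => i.
rewrite (euler_frobenius_rec_horner hPi); last first.
  by rewrite -natrD (eqr_nat _ _ 1) addn2.
by rewrite horner_sum; apply: eq_bigr => k _; rewrite !hornerE.
Qed.

(** At z = 1 only the term k = n of the recurrence survives. The value normalises both the symbol
    and Phi to 1 at z = 1. *)
Lemma euler_frobenius_at1 (R : realType) (Pi : nat -> {poly R}) :
  euler_frobenius Pi -> forall n : nat, (Pi n).[1] = n`!%:R.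
Proof.
move=> hPi; elim=> [|n IH]; first by case: hPi => -> _ _; rewrite hornerC.
rewrite (euler_frobenius_rec hPi) horner_sum big_ord_recr/= big1 ?add0r.
  by rewrite !hornerE IH subnn ?expr0 ?mulr1 binSn factS natrM /= mulr1.
move=> k _; rewrite !hornerE subrr expr0n.
by have := ltn_ord k; rewrite ltnNge -subn_eq0 => /negbTE ->; rewrite /= !mulr0.
Qed.

(** The generating function is expanded at w^2 in the variable 2s, at w and at -w; comparing
    coefficients of s^n and multiplying by n! (w^2 - 1)^(n+1) gives the identity. *)
Lemma euler_frobenius_duplication (R : realType) (Pi : nat -> {poly R}) :
  euler_frobenius Pi -> forall n : nat,
  2 ^+ n.+1 *: ('X * (Pi n \Po 'X^2)) =
  (1 + 'X) ^+ n.+1 * Pi n - (1 - 'X) ^+ n.+1 * (Pi n \Po - 'X).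
Proof.
move=> hPi n; apply: (@poly_eq_nat _ _ _ 2) => i.
set w : R := _ + _.
have w1 : 1 < w by rewrite /w; have := ler0n R i; lra.
clearbody w.
pose a z j := (Pi j).[z] / (z - 1) ^+ j / j`!%:R.
pose N := n.+1.
have w1' : w != 1 by rewrite gt_eqF.
have nw1 : - w != 1 by rewrite lt_eqF//; lra.
have w21 : w ^+ 2 != 1 by rewrite gt_eqF// expr2; nra.
have [M1 H1] := euler_frobenius_taylor hPi N w1'.
have [M2 H2] := euler_frobenius_taylor hPi N nw1.
have [M3 H3] := euler_frobenius_taylor hPi N w21.
pose T z := \poly_(i < N) a z i.
pose T2 := \poly_(i < N) (a (w ^+ 2) i * 2 ^+ i).
pose P := (2 * w / (w ^+ 2 - 1)) *: T2
   - (w - 1)^-1 *: T w - (w + 1)^-1 *: T (- w).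
have H3' : \forall s \near (0:R), `|(w ^+ 2 - 1) / (w ^+ 2 - expR (2 * s)) -
    T2.[s]| <= M3 * `|2 * s| ^+ N.
  have c2 : (fun s : R => 2 * s) s @[s --> (0:R)] --> (0:R).
    rewrite -[X in _ --> X](mulr0 2); apply: cvgM; [exact: cvg_cst | exact: cvg_id].
  near=> s; rewrite horner_poly.
  under eq_bigr do rewrite -mulrA -exprMn.
  by near: s; exact: (c2 _ H3).
have PO : exists M, \forall s \near (0 : R)^', `|P.[s]| <= M * `|s| ^+ N.
  exists (`|2 * w / (w ^+ 2 - 1)| * (M3 * 2 ^+ N) + `|(w - 1)^-1| * M1
    + `|(w + 1)^-1| * M2); near=> s.
  have n1 : w - expR s != 0 by near: s; apply: nbhs_dnbhs; exact: near_expR_neq.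
  have n2 : - w - expR s != 0 by near: s; apply: nbhs_dnbhs; exact: near_expR_neq.
  have e2 : expR (2 * s) = expR s ^+ 2 by rewrite expr2 -expRD; congr expR; ring.
  have n3 : w ^+ 2 - expR (2 * s) != 0.
    by rewrite e2 subr_sqr mulf_neq0// -oppr_eq0 opprD.
  have n4 : w ^+ 2 - 1 != 0 by rewrite subr_eq0.
  have n5 : w - 1 != 0 by rewrite subr_eq0.
  have n6 : w + 1 != 0 by rewrite gt_eqF//; lra.
  have -> : P.[s] =
      - (2 * w / (w ^+ 2 - 1) * ((w ^+ 2 - 1) / (w ^+ 2 - expR (2 * s)) - T2.[s]))
      + (w - 1)^-1 * ((w - 1) / (w - expR s) - (T w).[s])
      + (w + 1)^-1 * ((- w - 1) / (- w - expR s) - (T (- w)).[s]).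
    rewrite /P !hornerE.
    rewrite e2 in n3 *; field.
    by rewrite n1 n2 n3 n4 n5 n6.
  rewrite [leRHS]mulrDl; apply: le_trans (ler_normD _ _) _; apply: lerD.
    rewrite [leRHS]mulrDl; apply: le_trans (ler_normD _ _) _; apply: lerD.
      rewrite normrN normrM -[leRHS]mulrA ler_wpM2l//.
      have -> : M3 * 2 ^+ N * `|s| ^+ N = M3 * `|2 * s| ^+ N.
        by rewrite normrM (@ger0_norm _ 2)// exprMn mulrA.
      by near: s; apply: nbhs_dnbhs.
    rewrite normrM -[leRHS]mulrA ler_wpM2l// horner_poly.
    by near: s; apply: nbhs_dnbhs.
  rewrite normrM -[leRHS]mulrA ler_wpM2l// horner_poly.
  by near: s; apply: nbhs_dnbhs.
have := poly_bigO_coef PO (ltnSn n).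
rewrite /P !coefB !coefZ !coef_poly ltnSn /a.
rewrite !(hornerD, hornerN, hornerZ, hornerM, horner_exp, horner_comp,
  hornerX, hornerXn, hornerC).
move: (Pi n).[w] (Pi n).[- w] (Pi n).[w ^+ 2] => B C A E.
have f0 : n`!%:R != 0 :> R by rewrite pnatr_eq0 -lt0n fact_gt0.
have m0 : w - 1 != 0 by rewrite subr_eq0.
have p0 : w + 1 != 0 by rewrite gt_eqF//; lra.
have wE : w ^+ 2 - 1 = (w - 1) * (w + 1) by ring.
have e2 : (-1) ^+ n * (-1) ^+ n = 1 :> R by rewrite -expr2 sqrr_sign.
have e0 : (-1) ^+ n != 0 :> R by rewrite signr_eq0.
have nwE : (- w - 1) ^+ n = (-1) ^+ n * (w + 1) ^+ n.
  by rewrite -exprMn; congr (_ ^+ _); ring.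
have mwE : (1 - w) ^+ n = (-1) ^+ n * (w - 1) ^+ n.
  by rewrite -exprMn; congr (_ ^+ _); ring.
rewrite wE nwE exprMn in E.
rewrite !exprS mwE [1 + w]addrC.
have u0 : (w - 1) ^+ n != 0 by rewrite expf_neq0.
have v0 : (w + 1) ^+ n != 0 by rewrite expf_neq0.
move: E e0 e2 u0 v0 f0; clear mwE nwE.
move: ((-1) ^+ n) ((w - 1) ^+ n) ((w + 1) ^+ n) (n`!%:R) (2 ^+ n) => e u v f t.
move=> E e0 e2 u0 v0 f0; apply/eqP; rewrite -subr_eq0; apply/eqP.
(* Here [e] stands for (-1)^n. The second summand, zero since e^2 = 1, makes up for [field] treating
   [e] as a free variable. *)
transitivity ((w - 1) * (w + 1) * u * v * f * 0 + (1 - e * e) * (w - 1) * u * C / e).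
  by rewrite -E; field; rewrite f0 e0 p0 m0 u0 v0.
by rewrite e2; ring.
Unshelve. all: by end_near. Qed.

(** * The sinc series *)

Lemma sincN (R : realType) (x : R) : sinc (- x) = sinc x.
Proof. by rewrite /sinc oppr_eq0 sinN invrN mulrNN. Qed.

Lemma sinc_double (R : realType) (x : R) : sinc (2 * x) = cos x * sinc x.
Proof.
rewrite /sinc mulf_eq0 pnatr_eq0/=.
have [->|x0] := eqVneq x 0; first by rewrite cos0 mulr1.
have -> : sin (2 * x) = 2 * (cos x * sin x) by rewrite mulr_natl sin_mulr2n -mulr_natl.
by field.
Qed.

Lemma sqr_sin_shift (R : realType) (x : R) (l : nat) :
  sin (x + pi * l%:R) ^+ 2 = sin x ^+ 2.
Proof.
elim: l => [|l IH]; first by rewrite mulr0 addr0.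
by rewrite -addn1 natrD mulrDr mulr1 addrA sinDpi sqrrN.
Qed.

Lemma sqr_cos_shift (R : realType) (x : R) (l : nat) :
  cos (x + pi * l%:R) ^+ 2 = cos x ^+ 2.
Proof. by rewrite !cos2sin2 sqr_sin_shift. Qed.

Lemma sinc_cos (R : realType) (y : R) : 0 < y -> exists2 c, 0 < c < y & sinc y = cos c.
Proof.
move=> y0.
have [] := @MVT R sin cos 0 y y0 (fun x _ => is_derive_sin x).
  by apply: continuous_subspaceT => x; exact: continuous_sin.
move=> c; rewrite in_itv/= sin0 !subr0 => cy E; exists c => //.
by rewrite /sinc gt_eqF// E mulfK ?gt_eqF.
Qed.

Lemma sinc_ge0 (R : realType) (y : R) : 0 <= y <= pi -> 0 <= sinc y.
Proof.
move=> /andP[y0 y1]; rewrite /sinc; case: ifP => // _.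
by rewrite divr_ge0// sin_ge0_pi// y0.
Qed.

(** By the mean value theorem sinc y = cos c with 0 < c < y, and 1 - cos c <= sin c <= sin y in the
    first quadrant. *)
Lemma onem_sinc_bound (R : realType) (y : R) : 0 <= y <= pi / 2 ->
  0 <= 1 - sinc y <= sin y.
Proof.
have pi0 := pi_gt0 R.
move=> /andP[]; rewrite le_eqVlt => /predU1P[<- _|y0 y1].
  by rewrite /sinc eqxx subrr sin0 lexx.
have [c /andP[c0 cy] ->] := sinc_cos y0.
rewrite subr_ge0 cos_le1/=.
have sc0 : 0 <= sin c by apply: sin_ge0_pi; lra.
have cc0 : 0 <= cos c by apply: cos_ge0_pihalf; lra.
have cc1 := cos_le1 c; have sc1 := sin_le1 c.
have : sin c <= sin y.
  by apply/ltW; rewrite ltr_sin// in_itv/=; lra.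
apply: le_trans; have := cos2Dsin2 c; nra.
Qed.

(** Bernoulli's inequality, meant for x = sinc(pi v). *)
Lemma onemX_bound (R : realType) (x : R) (n : nat) : 0 <= x <= 1 ->
  0 <= 1 - x ^+ n <= n%:R * (1 - x).
Proof.
move=> /andP[x0 x1]; rewrite subr_ge0 exprn_ile1//=.
elim: n => [|n IH]; first by rewrite expr0 subrr mul0r.
have : x ^+ n <= 1 by rewrite exprn_ile1.
have : 0 <= x ^+ n by rewrite exprn_ge0.
by rewrite exprS -addn1 natrD; move: (x ^+ n) IH => u IH; nra.
Qed.

Definition sinc_sum (R : realType) (k : nat) (v : R) : R :=
  limn (series (fun l : nat => sinc (pi * (v + l%:R)) ^+ (2 * k + 2))).

(** As sinc is even, the indices l <= -1 at v are the indices l >= 0 at 1 - v. *)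
Lemma Q_sinc_sum (R : realType) (k : nat) (v : R) :
  Q (2 * k) v = sinc_sum k v + sinc_sum k (1 - v).
Proof.
rewrite /Q /sinc_sum; congr (_ + limn (series _)); apply/funext => l.
by rewrite -sincN -mulrN -natr1; congr (sinc (_ * _) ^+ _); ring.
Qed.

Lemma pi_ge1 (R : realType) : 1 <= pi :> R.
Proof. by have := pi_ge2 R; lra. Qed.

Lemma sin_pi_ge0 (R : realType) (v : R) : 0 <= v <= 1 -> 0 <= sin (pi * v).
Proof.
move=> /andP[v0 v1]; apply: sin_ge0_pi; have p0 := pi_gt0 R.
by nra.
Qed.

Lemma sinc_term_ge0 (R : realType) (k : nat) (x : R) : 0 <= sinc x ^+ (2 * k + 2).
Proof. by rewrite -mulnSr exprM exprn_ge0// sqr_ge0. Qed.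

(** The numerator sin^2(pi v) is independent of l; only one of its two factors is discarded, so that
    the tail of the series vanishes with sin(pi v). The denominator uses pi >= 1. *)
Lemma sinc_term_le (R : realType) (k l : nat) (v : R) : 0 <= v <= 1 ->
  sinc (pi * (v + l.+1%:R)) ^+ (2 * k + 2) <= sin (pi * v) / l.+1%:R ^+ 2.
Proof.
move=> v01; have s0 := sin_pi_ge0 v01; case/andP: v01 => v0 v1.
have p1 := @pi_ge1 R.
have l1 : 1 <= l.+1%:R :> R by rewrite ler1n.
set x := pi * _.
have xl : l.+1%:R <= x by rewrite /x; nra.
have x0 : 0 < x by lra.
have E : sinc x ^+ 2 = sin (pi * v) ^+ 2 / x ^+ 2.
  by rewrite /sinc gt_eqF// expr_div_n /x mulrDr sqr_sin_shift.
have s1 := sin_le1 (pi * v).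
have B : sinc x ^+ 2 <= sin (pi * v) / l.+1%:R ^+ 2.
  rewrite E; apply: ler_pM; rewrite ?invr_ge0 ?sqr_ge0//.
    by rewrite expr2 ler_piMr.
  rewrite lef_pV2 ?posrE ?exprn_gt0//.
  by rewrite lerXn2r// nnegrE; lra.
rewrite -mulnSr exprM exprS; apply: le_trans B.
rewrite ler_piMr ?sqr_ge0// exprn_ile1 ?sqr_ge0//.
rewrite E ler_pdivrMr ?exprn_gt0// mul1r lerXn2r// ?nnegrE; lra.
Qed.

Lemma sinc_series_le (R : realType) (k n : nat) (v : R) : 0 <= v <= 1 ->
  series (fun l : nat => sinc (pi * (v + l%:R)) ^+ (2 * k + 2)) n.+1 <=
  sinc (pi * v) ^+ (2 * k + 2) + 2 * sin (pi * v).
Proof.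
move=> v01; have s0 := sin_pi_ge0 v01.
rewrite /series /= big_mkord big_ord_recl addr0 lerD2l.
(* The majorant telescopes: 1/a^2 <= 2/a - 2/(a+1) for a >= 1. *)
suff : \sum_(i < n) sinc (pi * (v + (lift ord0 i)%:R)) ^+ (2 * k + 2) <=
    sin (pi * v) * (2 - 2 / n.+1%:R).
  move=> /le_trans; apply; rewrite mulrC ler_wpM2r// gerBl divr_ge0//.
elim: n => [|n IH]; first by rewrite big_ord0 divr1 subrr mulr0.
rewrite big_ord_recr /=; apply: le_trans (lerD IH (sinc_term_le k n v01)) _.
rewrite -mulrDr ler_wpM2l// -[n.+2%:R]natr1.
have n0 : 0 < n.+1%:R :> R by [].
move: n0; set a : R := n.+1%:R => a0; have a1 : 1 <= a by rewrite ler1n.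
rewrite -subr_ge0; have -> : 2 - 2 / (a + 1) - (2 - 2 / a + (a ^+ 2)^-1) =
  (a - 1) / ((a + 1) * a ^+ 2) by field; lra.
by rewrite divr_ge0 ?mulr_ge0 ?sqr_ge0//; lra.
Qed.

Lemma sinc_series_cvg (R : realType) (k : nat) (v : R) : 0 <= v <= 1 ->
  cvgn (series (fun l : nat => sinc (pi * (v + l%:R)) ^+ (2 * k + 2))).
Proof.
move=> v01; apply: nondecreasing_is_cvgn.
  apply/nondecreasing_seqP => n.
  by rewrite /series /= big_nat_recr//= lerDl sinc_term_ge0.
exists (sinc (pi * v) ^+ (2 * k + 2) + 2 * sin (pi * v)) => _ [n _ <-].
apply: le_trans (sinc_series_le k n v01).
by rewrite /series /= big_nat_recr//= lerDl sinc_term_ge0.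
Qed.

Lemma sinc_sum_bounds (R : realType) (k : nat) (v : R) : 0 <= v <= 1 ->
  sinc (pi * v) ^+ (2 * k + 2) <= sinc_sum k v <=
  sinc (pi * v) ^+ (2 * k + 2) + 2 * sin (pi * v).
Proof.
move=> v01; apply/andP; split.
  apply: limr_ge; first exact: sinc_series_cvg.
  exists 1%N => // -[//|n] _ /=.
  rewrite /series /= big_mkord big_ord_recl addr0 lerDl sumr_ge0// => i _.
  exact: sinc_term_ge0.
apply: limr_le; first exact: sinc_series_cvg.
exists 1%N => // -[//|n] _ /=; exact: sinc_series_le.
Qed.

Lemma cvg_double_oo : (fun n : nat => n.*2) @ \oo --> \oo.
Proof.
move=> A [N _ HN]; exists N => // n /= Nn; apply: HN => /=.
by rewrite (leq_trans Nn)// -addnn leq_addr.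
Qed.

(** The exponent 2k + 2 is even, so the sign of cos(x + pi l) drops out and the cosine factor leaves
    the sum; for odd indices a further shift by pi/2 turns it into a sine. *)
Lemma sinc_sum_double (R : realType) (k : nat) (v : R) : 0 <= v <= 1 ->
  sinc_sum k v = cos (pi * v / 2) ^+ (2 * k + 2) * sinc_sum k (v / 2)
    + sin (pi * v / 2) ^+ (2 * k + 2) * sinc_sum k ((v + 1) / 2).
Proof.
move=> v01.
pose t (v : R) (l : nat) : R := sinc (pi * (v + l%:R)) ^+ (2 * k + 2).
set c := cos _ ^+ _; set s := sin _ ^+ _.
have ev (l : nat) : t v l.*2 = c * t (v / 2) l.
  rewrite /t /c -exprMn -mulnSr !(exprM _ 2%N); congr (_ ^+ _).
  have -> : pi * (v + l.*2%:R) = 2 * (pi * (v / 2 + l%:R)).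
    by rewrite -muln2 natrM; field.
  rewrite sinc_double !exprMn; congr (_ * _).
  by rewrite mulrDr sqr_cos_shift mulrA.
have od (l : nat) : t v l.*2.+1 = s * t ((v + 1) / 2) l.
  rewrite /t /s -exprMn -mulnSr !(exprM _ 2%N); congr (_ ^+ _).
  have -> : pi * (v + l.*2.+1%:R) = 2 * (pi * ((v + 1) / 2 + l%:R)).
    by rewrite -natr1 -muln2 natrM; field.
  rewrite sinc_double !exprMn; congr (_ * _).
  rewrite mulrDr sqr_cos_shift.
  have -> : pi * ((v + 1) / 2) = pi * v / 2 + pi / 2 by field.
  by rewrite cosDpihalf sqrrN.
have part n : series (t v) n.*2 = c * series (t (v / 2)) n + s * series (t ((v + 1) / 2)) n.
  elim: n => [|n IH]; first by rewrite /series /= !big_geq// !mulr0 addr0.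
  by rewrite doubleS !seriesSr IH ev od; ring.
case/andP: v01 => v0 v1.
have c1 : series (t (v / 2)) @ \oo --> sinc_sum k (v / 2).
  by apply: sinc_series_cvg; lra.
have c2 : series (t ((v + 1) / 2)) @ \oo --> sinc_sum k ((v + 1) / 2).
  by apply: sinc_series_cvg; lra.
have c0 : series (t v) @ \oo --> sinc_sum k v.
  by apply: sinc_series_cvg; lra.
have c0' : (fun n => series (t v) n.*2) @ \oo --> sinc_sum k v.
  exact: (cvg_comp _ _ cvg_double_oo c0).
have c3 : (fun n => series (t v) n.*2) @ \oo -->
    c * sinc_sum k (v / 2) + s * sinc_sum k ((v + 1) / 2).
  have -> : (fun n => series (t v) n.*2) =
    (fun n => c * series (t (v / 2)) n + s * series (t ((v + 1) / 2)) n).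
    by apply/funext => n; exact: part.
  by apply: cvgD; apply: cvgM => //; exact: cvg_cst.
by rewrite -(cvg_lim _ c0')// -(cvg_lim _ c3).
Qed.

(** Replacing v by 1 - v exchanges the cosine and sine factors and sends v/2 and (v+1)/2 to 1 -
    (v+1)/2 and 1 - v/2, so the four half sums regroup into two values of [Q]. *)
Lemma Q_double (R : realType) (k : nat) (v : R) : 0 <= v <= 1 ->
  Q (2 * k) v = cos (pi * v / 2) ^+ (2 * k + 2) * Q (2 * k) (v / 2)
    + sin (pi * v / 2) ^+ (2 * k + 2) * Q (2 * k) ((v + 1) / 2).
Proof.
move=> v01; rewrite !Q_sinc_sum sinc_sum_double// (@sinc_sum_double _ _ (1 - v)); last lra.
have -> : pi * (1 - v) / 2 = pi / 2 - pi * v / 2 by field.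
have -> : cos (pi / 2 - pi * v / 2) = sin (pi * v / 2).
  by rewrite -cosN opprB cosBpihalf.
have -> : sin (pi / 2 - pi * v / 2) = cos (pi * v / 2).
  by rewrite -[LHS]opprK -sinN opprB sinBpihalf opprK.
have -> : (1 - v) / 2 = 1 - (v + 1) / 2 by field.
have -> : (1 - v + 1) / 2 = 1 - v / 2 by field.
ring.
Qed.

(** After reflection to v <= 1/2, the l = 0 term is within (2k+2) sin(pi v) of 1, the l = -1 term is
    at most sin(pi v), and each of the two tails is at most 2 sin(pi v): in all 2k + 7. *)
Lemma Q_near1 (R : realType) (k : nat) (v : R) : 0 <= v <= 1 ->
  `|Q (2 * k) v - 1| <= (2 * k + 7)%:R * sin (pi * v).
Proof.
have sym (u : R) : sin (pi * (1 - u)) = sin (pi * u).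
  by rewrite mulrBr mulr1 addrC sinDpi sinN opprK.
wlog vh : v / v <= 1 / 2.
  move=> H v01; have [vh|vh] := leP v (1 / 2); first exact: H.
  rewrite -sym (_ : Q _ v = Q (2 * k) (1 - v)); first by apply: H; lra.
  by rewrite !Q_sinc_sum subKr addrC.
move=> v01; have s0 := sin_pi_ge0 v01.
have v01' : 0 <= 1 - v <= 1 by lra.
have := sinc_sum_bounds k v01; have := sinc_sum_bounds k v01'; rewrite sym.
rewrite Q_sinc_sum.
have p0 := pi_gt0 R; have p1 := pi_ge2 R; case/andP: v01 => v0 v1.
have y01 : 0 <= pi * v <= pi / 2 by nra.
have := onem_sinc_bound y01.
move=> /andP[a1 a2].
have x01 : 0 <= sinc (pi * v) <= 1.
  by rewrite -[_ <= 1]subr_ge0 a1 andbT sinc_ge0//; lra.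
have := onemX_bound (2 * k + 2) x01.
have : (2 * k + 2)%:R * (1 - sinc (pi * v)) <= (2 * k + 2)%:R * sin (pi * v).
  by rewrite ler_wpM2l.
have : 0 <= sinc (pi * (1 - v)) ^+ (2 * k + 2) <= sin (pi * v).
  rewrite sinc_term_ge0/=.
  have b : sinc (pi * (1 - v)) <= sin (pi * v).
    rewrite /sinc gt_eqF; last by nra.
    by rewrite sym ler_piMr// invf_le1; nra.
  have b0 : 0 <= sinc (pi * (1 - v)) by apply: sinc_ge0; nra.
  have sl1 := sin_le1 (pi * v).
  rewrite addn2 exprS; apply: (le_trans _ b); rewrite ler_piMr// exprn_ile1//.
  exact: le_trans b sl1.
rewrite (_ : (2 * k + 7)%:R = (2 * k + 2)%:R + 5); last by rewrite -natrD -addnA.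
move=> h1 h2 h3 h4 h5; rewrite [leRHS]mulrDl; move: h2 h3.
set mw := (2 * k + 2)%:R * (1 - _); set ms := (2 * k + 2)%:R * sin _ => h2 h3.
by rewrite ler_norml; lra.
Qed.

(** * The sinc series as an Euler-Frobenius symbol *)

Lemma cisD (R : realType) (a b : R) : cis (a + b) = cis a * cis b.
Proof.
rewrite /cis cosD sinD; apply/eqP; rewrite eq_complex /= eqxx /=.
by rewrite addrC [cos a * _]mulrC [sin a * _]mulrC mulrC.
Qed.

Lemma cis0 (R : realType) : cis (0 : R) = 1.
Proof. by rewrite /cis cos0 sin0. Qed.

Lemma norm_cis (R : realType) (a : R) : `|cis a| = 1.
Proof. by rewrite normc_def /= cos2Dsin2 sqrtr1. Qed.

Lemma cis_neq0 (R : realType) (a : R) : cis a != 0.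
Proof. by rewrite -normr_eq0 norm_cis oner_eq0. Qed.

Lemma cisN (R : realType) (a : R) : cis (- a) = (cis a)^-1.
Proof.
by apply: (mulIf (cis_neq0 a)); rewrite -cisD addNr cis0 mulVf// cis_neq0.
Qed.

Lemma conjc_cis (R : realType) (a : R) : conjc (cis a) = (cis a)^-1.
Proof. by rewrite -cisN /cis cosN sinN. Qed.

Lemma cis_addV (R : realType) (a : R) :
  cis a + (cis a)^-1 = 2 * real_complex R (cos a).
Proof.
rewrite -conjc_cis /cis -(rmorph_nat (real_complex R)).
by apply/eqP; rewrite eq_complex /=; apply/andP; split; apply/eqP; ring.
Qed.

Lemma cis_subV (R : realType) (a : R) :
  cis a - (cis a)^-1 = 2 * ('i%C * real_complex R (sin a)).
Proof.
rewrite -conjc_cis /cis -(rmorph_nat (real_complex R)).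
by apply/eqP; rewrite eq_complex /=; apply/andP; split; apply/eqP; ring.
Qed.

Lemma horner_norm_le (R : realType) (G : {poly R[i]}) :
  exists2 B : R, 0 <= B & forall z : R[i], `|z| = 1 -> `|G.[z]| <= real_complex R B.
Proof.
exists (\sum_(i < size G) ComplexField.Normc.normc G`_i).
  apply: sumr_ge0 => i _; rewrite -ler0c.
  by rewrite (_ : real_complex R _ = `|G`_i|)//.
move=> z z1; rewrite horner_coef rmorph_sum /=.
apply: le_trans (ler_norm_sum _ _ _) _; apply: ler_sum => i _.
by rewrite normrM normrX z1 expr1n mulr1.
Qed.

Lemma euler_frobenius_duplicationC (R : realType) (Pi : nat -> {poly R}) :
  euler_frobenius Pi -> forall (n : nat) (w : R[i]),
  2 ^+ n.+1 * (w * (polyC_of (Pi n)).[w ^+ 2]) =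
  (1 + w) ^+ n.+1 * (polyC_of (Pi n)).[w]
  - (1 - w) ^+ n.+1 * (polyC_of (Pi n)).[- w].
Proof.
move=> hPi n w; have /(congr1 (fun P => (polyC_of P).[w])) := euler_frobenius_duplication hPi n.
rewrite /polyC_of map_polyZ !(rmorphB, rmorphM, rmorphXn, rmorphD, rmorph1) /=.
rewrite !map_comp_poly rmorphN /= !map_polyXn !map_polyX.
by rewrite !(hornerD, hornerN, hornerZ, hornerM, horner_exp, horner_comp,
  hornerX, hornerXn, hornerC).
Qed.

Definition zarg (R : realType) (v : R) : R[i] := cis (- (2 * pi * v)).

(** On the unit circle, the Fourier symbol of the integer samples of the centred cardinal B-spline
    of degree 2k + 1. *)
Definition EF_symbol (R : realType) (Pi : nat -> {poly R}) (k : nat) (z : R[i]) : R[i] :=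
  z ^- k * ((polyC_of (Pi (2 * k).+1)).[z] / ((2 * k).+1)`!%:R).

(** With w = exp(-i pi v) and y = pi v / 2, 1 + w = 2 cos(y) e^(-iy) and 1 - w = 2i sin(y) e^(-iy).
    Their powers of exponent 2k + 2 carry w^(k+1) and (-w)^(k+1), which match the prefactors z^-k in
    the duplication formula. *)
Lemma EF_symbol_double (R : realType) (Pi : nat -> {poly R}) :
  euler_frobenius Pi -> forall (k : nat) (v : R),
  EF_symbol Pi k (zarg v) =
    real_complex R (cos (pi * v / 2) ^+ (2 * k + 2)) * EF_symbol Pi k (zarg (v / 2))
  + real_complex R (sin (pi * v / 2) ^+ (2 * k + 2)) * EF_symbol Pi k (zarg ((v + 1) / 2)).
Proof.
move=> hPi k v; set w := zarg (v / 2); set y := pi * v / 2.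
have wE : w = cis (- y) ^+ 2.
  by rewrite expr2 -cisD /w /zarg /y; congr cis; field.
have -> : zarg v = w ^+ 2.
  by rewrite /w expr2 -cisD /zarg; congr cis; field.
have -> : zarg ((v + 1) / 2) = - w.
  rewrite /w /zarg /cis; have -> : - (2 * pi * ((v + 1) / 2)) = - (2 * pi * (v / 2)) - pi by field.
  move: (- (2 * pi * (v / 2))) => a.
  have -> : cos (a - pi) = - cos a by rewrite -[in RHS](subrK pi a) cosDpi opprK.
  by have -> : sin (a - pi) = - sin a by rewrite -[in RHS](subrK pi a) sinDpi opprK.
have w0 : w != 0 by rewrite cis_neq0.
have e0 := cis_neq0 (- y).
have wp : (1 + w) ^+ (2 * k).+2 =
    2 ^+ (2 * k).+2 * real_complex R (cos y ^+ (2 * k + 2)) * w ^+ k.+1.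
  have -> : 1 + w = cis (- y) * (2 * real_complex R (cos y)).
    by rewrite -(cosN y) -cis_addV mulrDr mulfV// wE -expr2 addrC.
  rewrite -[(2 * k).+2]addn2 rmorphXn !exprMn mulrC -!mulrA; congr (_ * (_ * _)).
  by rewrite wE -exprM mulnS addnC.
have wm : (1 - w) ^+ (2 * k).+2 =
    2 ^+ (2 * k).+2 * real_complex R (sin y ^+ (2 * k + 2)) * (- w) ^+ k.+1.
  have -> : 1 - w = cis (- y) * (2 * ('i%C * real_complex R (sin y))).
    rewrite -[sin y]opprK -sinN rmorphN !mulrN -cis_subV mulrBr mulfV// wE -expr2.
    by rewrite opprB.
  rewrite -[(2 * k).+2]addn2 rmorphXn !exprMn -!mulrA mulrCA; congr (_ * _).
  rewrite mulrCA mulrA mulrC; congr (_ * _).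
  rewrite -[(2 * k + 2)%N]mulnSr !(exprM _ 2%N) -exprMn; congr (_ ^+ _).
  by rewrite sqr_i wE mulN1r.
have := euler_frobenius_duplicationC hPi (2 * k).+1 w.
rewrite wp wm /EF_symbol.
move: (_.[w ^+ 2]) (_.[w]) (_.[- w]) => A B C E.
have f0 : ((2 * k).+1)`!%:R != 0 :> R[i] by rewrite pnatr_eq0 -lt0n fact_gt0.
have t0 : 2 ^+ (2 * k).+2 != 0 :> R[i] by rewrite expf_neq0// pnatr_eq0.
have u0 : w ^+ k != 0 by rewrite expf_neq0.
have sE : (- w) ^+ k = (-1) ^+ k * w ^+ k by exact: (exprNn w k).
have s2 : (-1) ^+ k * (-1) ^+ k = 1 :> R[i] by rewrite -expr2 sqrr_sign.
have s0 : (-1) ^+ k != 0 :> R[i] by rewrite signr_eq0.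
rewrite (exprS w) (exprS (- w)) sE in E.
have -> : (w ^+ 2) ^+ k = w ^+ k * w ^+ k by rewrite -exprM mulnC exprM expr2.
rewrite sE; move: E f0 t0 u0 s2 s0.
move: (w ^+ k) ((-1) ^+ k) (_`!%:R) (2 ^+ _) (real_complex R _) (real_complex R _).
move=> u s f t d c E f0 t0 u0 s2 s0.
have {}E : w * A = c * (w * u) * B + d * (w * (s * u)) * C.
  by apply: (mulfI t0); rewrite E; ring.
have {}E : A = c * u * B + d * s * u * C.
  by apply: (mulfI w0); rewrite E; ring.
rewrite E; have -> : d * ((s * u)^-1 * (C / f)) = d * s * C / (u * f).
  have -> : d * s * C / (u * f) = d * (s * s) * C / (s * u * f) by field; rewrite f0 u0 s0.
  by rewrite s2; field; rewrite f0 u0 s0.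
by field; rewrite f0 u0.
Qed.

(** Pi_(2k+1)(z) / (2k+1)! - z^k vanishes at 1, so it is z - 1 times a polynomial bounded on the
    unit circle, and |z - 1| = 2 |sin(pi v)|. *)
Lemma EF_symbol_near1 (R : realType) (Pi : nat -> {poly R}) :
  euler_frobenius Pi -> forall k : nat, exists2 B : R, 0 <= B &
  forall v : R, `|EF_symbol Pi k (zarg v) - 1| <= real_complex R (B * `|sin (pi * v)|).
Proof.
move=> hPi k.
pose P := ((2 * k).+1)`!%:R^-1 *: polyC_of (Pi (2 * k).+1) - 'X^k.
have f0 : ((2 * k).+1)`!%:R != 0 :> R[i] by rewrite pnatr_eq0 -lt0n fact_gt0.
have : root P 1.
  rewrite /root /P hornerD hornerN hornerZ hornerXn expr1n.
  rewrite /polyC_of -[X in _.[X]](rmorph1 (real_complex R)) horner_map/=.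
  by rewrite (euler_frobenius_at1 hPi) rmorph_nat mulVf// subrr.
move=> /factor_theorem[G PE]; have [B B0 HB] := horner_norm_le G.
exists (B * 2); first by rewrite mulr_ge0.
move=> v; have z1 : `|zarg v| = 1 by exact: norm_cis.
have z0 : zarg v != 0 by exact: cis_neq0.
have -> : EF_symbol Pi k (zarg v) - 1 = zarg v ^- k * P.[zarg v].
  rewrite /P hornerD hornerN hornerZ hornerXn mulrBr mulVf ?expf_neq0//.
  by rewrite /EF_symbol [_ / _]mulrC.
rewrite normrM normfV normrX z1 expr1n invr1 mul1r PE hornerM normrM hornerXsubC.
rewrite -mulrA rmorphM /= ler_pM ?normr_ge0 ?HB//.
have -> : zarg v - 1 = cis (- (pi * v)) * (cis (- (pi * v)) - (cis (- (pi * v)))^-1).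
  by rewrite mulrBr mulfV ?cis_neq0// -cisD /zarg; congr (cis _ - _); ring.
rewrite cis_subV normrM norm_cis mul1r !normrM sinN rmorphN normrN normr_nat rmorphM rmorph_nat.
rewrite ler_pM2l ?ltr0n// [`|'i%C|]normc_def /= expr0n expr1n add0r sqrtr1 mul1r.
by rewrite normc_def /= expr0n addr0 sqrtr_sqr.
Qed.

Theorem Q_EF_symbol (R : realType) (Pi : nat -> {poly R}) :
  euler_frobenius Pi -> forall (k : nat) (v : R), 0 <= v <= 1 ->
  real_complex R (Q (2 * k) v) = EF_symbol Pi k (zarg v).
Proof.
move=> hPi k; have [B B0 HB] := EF_symbol_near1 hPi k.
pose M : R := (2 * k + 7)%:R + B.
pose D v := real_complex R (Q (2 * k) v) - EF_symbol Pi k (zarg v).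
have bnd n v : 0 <= v <= 1 ->
    `|D v| <= real_complex R (M * (3 / 4) ^+ n * sin (pi * v)).
  elim: n v => [|n IH] v v01.
    have s0 := sin_pi_ge0 v01.
    have -> : D v = (real_complex R (Q (2 * k) v) - 1) - (EF_symbol Pi k (zarg v) - 1).
      by rewrite /D; ring.
    apply: le_trans (ler_normB _ _) _.
    rewrite expr0 mulr1 (mulrDl _ B) [leRHS]rmorphD /=; apply: lerD.
      rewrite -(rmorph1 (real_complex R)) -rmorphB normc_def /= expr0n addr0 sqrtr_sqr lecR.
      exact: Q_near1.
    by apply: le_trans (HB v) _; rewrite ger0_norm.
  have -> : D v = real_complex R (cos (pi * v / 2) ^+ (2 * k + 2)) * D (v / 2)
     + real_complex R (sin (pi * v / 2) ^+ (2 * k + 2)) * D ((v + 1) / 2).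
    by rewrite /D (EF_symbol_double hPi) Q_double// rmorphD !rmorphM/=; ring.
  have v1 : 0 <= v / 2 <= 1 by lra.
  have v2 : 0 <= (v + 1) / 2 <= 1 by lra.
  have s0 : 0 <= sin (pi * v / 2) by rewrite -mulrA; exact: sin_pi_ge0.
  have sc : sin (pi * ((v + 1) / 2)) = cos (pi * v / 2).
    by rewrite -sinDpihalf; congr sin; field.
  have c0 : 0 <= cos (pi * v / 2) by rewrite -sc; exact: sin_pi_ge0.
  have ss : sin (pi * v) = 2 * (cos (pi * v / 2) * sin (pi * v / 2)).
    by rewrite mulr_natl -sin_mulr2n -mulr_natl; congr sin; field.
  have := IH _ v1; have := IH _ v2; rewrite sc mulrA => h2 h1.
  have cs := cos2Dsin2 (pi * v / 2).
  rewrite ss; move: s0 c0 h1 h2 cs.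
  move: (cos _) (sin _) => c s s0 c0 h1 h2 cs.
  have M0 : 0 <= M * (3 / 4) ^+ n.
    by rewrite mulr_ge0 ?exprn_ge0// /M addr_ge0//.
  apply: le_trans (ler_normD _ _) _; rewrite !normrM.
  have nr (x : R) : 0 <= x -> `|real_complex R x| = real_complex R x.
    by move=> x0; rewrite ger0_norm// ler0c.
  rewrite !nr ?exprn_ge0//.
  apply: (@le_trans _ _ (real_complex R (c ^+ (2 * k + 2) * (M * (3 / 4) ^+ n * s)
     + s ^+ (2 * k + 2) * (M * (3 / 4) ^+ n * c)))).
    rewrite rmorphD !(rmorphM _ (_ ^+ (2 * k + 2))) /=.
    by apply: lerD; rewrite ler_wpM2l// ler0c exprn_ge0.
  rewrite lecR exprSr (mulrA M); move: (M * _) M0 => q q0.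
  have c1 : c <= 1 by nra.
  have s1 : s <= 1 by nra.
  (* Lowering the powers to squares leaves q c s (c + s) to be estimated. *)
  have pw (x : R) : 0 <= x -> x <= 1 -> x ^+ (2 * k + 2) <= x ^+ 2.
    move=> x0 x1; rewrite addnC exprD ler_piMr ?sqr_ge0//.
    exact: exprn_ile1.
  have hc := pw c c0 c1; have hs := pw s s0 s1.
  have qs : 0 <= q * s by rewrite mulr_ge0.
  have qc : 0 <= q * c by rewrite mulr_ge0.
  have h3 := ler_wpM2r qs hc; have h4 := ler_wpM2r qc hs.
  apply: le_trans (lerD h3 h4) _.
  have h5 : c + s <= 3 / 2.
    have := sqr_ge0 (c - s); rewrite sqrrB => h; nra.
  have qcs : 0 <= q * c * s by rewrite !mulr_ge0.
  have := ler_wpM2l qcs h5; nra.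
move=> v v01; apply/eqP; rewrite -subr_eq0 -normr_eq0 -/(D v) normc_def.
have dl n := bnd n v v01.
rewrite normc_def in dl.
set d := Num.sqrt _ in dl *.
have d0 : 0 <= d by exact: sqrtr_ge0.
have {}dl n : d <= M * sin (pi * v) * (3 / 4) ^+ n.
  by have := dl n; rewrite lecR mulrAC.
have cg : geometric (M * sin (pi * v)) (3 / 4) @ \oo --> (0 : R).
  by apply: cvg_geometric; rewrite ger0_norm; lra.
have d1 : d <= 0.
  apply: (ler_cvg_to (cvg_cst d) cg); near=> n; exact: dl.
by rewrite (_ : d = 0)//; apply/eqP; rewrite eq_le d1.
Unshelve. all: by end_near. Qed.

(** * Integrals of complex-valued functions *)

(** Componentwise, to match [Cintegral], which integrates real and imaginary parts separately. *)
Definition ccont (R : realType) (f : R -> R[i]) : Prop :=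
  continuous (fun u => complex.Re (f u)) /\ continuous (fun u => complex.Im (f u)).

Lemma ccont_cst (R : realType) (c : R[i]) : ccont (fun _ : R => c).
Proof. by split=> u; exact: cvg_cst. Qed.

Lemma ccontD (R : realType) (f g : R -> R[i]) :
  ccont f -> ccont g -> ccont (fun u => f u + g u).
Proof.
move=> [f1 f2] [g1 g2]; split=> u.
  rewrite (_ : (fun u => _) = (fun u => complex.Re (f u) + complex.Re (g u))).
    by apply: cvgD; [exact: f1 | exact: g1].
  by apply/funext => x; case: (f x) (g x) => ? ? [].
rewrite (_ : (fun u => _) = (fun u => complex.Im (f u) + complex.Im (g u))).
  by apply: cvgD; [exact: f2 | exact: g2].
by apply/funext => x; case: (f x) (g x) => ? ? [].
Qed.

Lemma ccontM (R : realType) (f g : R -> R[i]) :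
  ccont f -> ccont g -> ccont (fun u => f u * g u).
Proof.
move=> [f1 f2] [g1 g2]; split=> u.
  rewrite (_ : (fun u => _) = (fun u =>
    complex.Re (f u) * complex.Re (g u) - complex.Im (f u) * complex.Im (g u))).
    by apply: cvgB; apply: cvgM; [exact: f1 | exact: g1 | exact: f2 | exact: g2].
  by apply/funext => x; case: (f x) (g x) => ? ? [].
rewrite (_ : (fun u => _) = (fun u =>
  complex.Re (f u) * complex.Im (g u) + complex.Im (f u) * complex.Re (g u))).
  by apply: cvgD; apply: cvgM; [exact: f1 | exact: g2 | exact: f2 | exact: g1].
by apply/funext => x; case: (f x) (g x) => ? ? [].
Qed.

Lemma ccontV (R : realType) (f : R -> R[i]) :
  ccont f -> (forall u, f u != 0) -> ccont (fun u => (f u)^-1).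
Proof.
move=> [f1 f2] f0.
pose n u := complex.Re (f u) ^+ 2 + complex.Im (f u) ^+ 2.
have n0 u : n u != 0.
  rewrite /n paddr_eq0 ?sqr_ge0// !sqrf_eq0.
  by have := f0 u; rewrite eq_complex.
have nc : continuous n.
  move=> u; rewrite /n.
  by apply: cvgD; rewrite expr2; apply: cvgM; [exact: f1 | exact: f1 | exact: f2 | exact: f2].
have nV : continuous (fun u => (n u)^-1) by move=> u; apply: cvgV; [exact: n0 | exact: nc].
split=> u.
  rewrite (_ : (fun u => _) = (fun u => complex.Re (f u) * (n u)^-1)).
    by apply: cvgM; [exact: f1 | exact: nV].
  by apply/funext => x; rewrite /n; case: (f x).
rewrite (_ : (fun u => _) = (fun u => - (complex.Im (f u) * (n u)^-1))).
  by apply: cvgN; apply: cvgM; [exact: f2 | exact: nV].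
by apply/funext => x; rewrite /n; case: (f x).
Qed.

Lemma ccont_sum (R : realType) (I : Type) (s : seq I) (f : I -> R -> R[i]) :
  (forall i, ccont (f i)) -> ccont (fun u => \sum_(i <- s) f i u).
Proof.
move=> H; elim: s => [|i s IH].
  by under eq_fun do rewrite big_nil; exact: ccont_cst.
by under eq_fun do rewrite big_cons; exact: ccontD.
Qed.

Lemma ccont_cis (R : realType) (a : R) : ccont (fun u => cis (a * u)).
Proof.
have c : continuous (fun u : R => a * u).
  by move=> u; apply: cvgM; [exact: cvg_cst | exact: cvg_id].
split=> u /=.
  by apply: (cvg_comp _ _ (c u)); exact: continuous_cos.
by apply: (cvg_comp _ _ (c u)); exact: continuous_sin.
Qed.

Lemma itv_integrable (R : realType) (a b : R) (f : R -> R) :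
  continuous f -> lebesgue_measure.-integrable `[a, b] (EFin \o f).
Proof.
move=> fc; apply: continuous_compact_integrable; first exact: segment_compact.
exact: continuous_subspaceT.
Qed.

Lemma CintegralD (R : realType) (a b : R) (f g : R -> R[i]) :
  ccont f -> ccont g ->
  Cintegral `[a, b] (fun u => f u + g u) = Cintegral `[a, b] f + Cintegral `[a, b] g.
Proof.
move=> [f1 f2] [g1 g2]; rewrite /Cintegral.
apply/eqP; rewrite eq_complex /= -!RintegralD//; do ?exact: itv_integrable.
by apply/andP; split; apply/eqP; apply: eq_Rintegral => x _; case: (f x) (g x) => ? ? [].
Qed.

Lemma CintegralZ (R : realType) (a b : R) (c : R[i]) (f : R -> R[i]) :
  ccont f -> Cintegral `[a, b] (fun u => c * f u) = c * Cintegral `[a, b] f.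
Proof.
move=> [f1 f2]; rewrite /Cintegral; case: c => c d.
have cM (x : R) (h : R -> R) : continuous h -> continuous (fun u => x * h u).
  by move=> hc u; apply: cvgM; [exact: cvg_cst | exact: hc].
apply/eqP; rewrite eq_complex /= -!RintegralZl//; do ?exact: itv_integrable.
rewrite -RintegralB// -?RintegralD//; do ?(apply: itv_integrable; exact: cM).
by apply/andP; split; apply/eqP; apply: eq_Rintegral => x _; case: (f x).
Qed.

Lemma Cintegral_sum (R : realType) (a b : R) (I : Type) (s : seq I) (f : I -> R -> R[i]) :
  (forall i, ccont (f i)) ->
  Cintegral `[a, b] (fun u => \sum_(i <- s) f i u) = \sum_(i <- s) Cintegral `[a, b] (f i).
Proof.
move=> H; elim: s => [|i s IH].
  rewrite big_nil -[RHS](mul0r (Cintegral `[a, b] (fun _ : R => 0))).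
  rewrite -CintegralZ; last exact: ccont_cst.
  by congr Cintegral; apply/funext => u; rewrite mul0r big_nil.
rewrite (_ : (fun u => _) = (fun u => f i u + \sum_(j <- s) f j u)); last first.
  by apply/funext => u; rewrite big_cons.
by rewrite CintegralD//; [rewrite IH big_cons | exact: ccont_sum].
Qed.

Lemma eq_Cintegral (R : realType) (D : set R) (f g : R -> R[i]) :
  {in D, f =1 g} -> Cintegral D f = Cintegral D g.
Proof.
by move=> fg; rewrite /Cintegral; congr Complex; apply: eq_Rintegral => x xD; rewrite fg.
Qed.

Lemma Rintegral_itv_cst (R : realType) (K c : R) : 0 < K ->
  \int[lebesgue_measure]_(u in `[0, K]) c = c * K.
Proof.
move=> K0; rewrite Rintegral_cst//; congr (_ * _).
have h : fine (lebesgue_measure (`[0, K]%classic : set R)) = K.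
  by rewrite lebesgue_measure_itv /= lte_fin K0 /= subr0.
exact: h.
Qed.

Lemma Cintegral_cst (R : realType) (K : R) (c : R[i]) : 0 < K ->
  Cintegral `[0, K] (fun _ => c) = real_complex R K * c.
Proof.
move=> K0; rewrite /Cintegral !Rintegral_itv_cst//.
by case: c => x y; apply/eqP; rewrite eq_complex /=; apply/andP; split; apply/eqP; ring.
Qed.

(** The factor 2 comes from |z| <= |Re z| + |Im z|; it is harmless, as the pole integrals only have
    to be bounded uniformly in the exponent. *)
Lemma Cintegral_bound (R : realType) (K B : R) (f : R -> R[i]) : 0 < K ->
  ccont f -> (forall u, `|f u| <= real_complex R B) ->
  `|Cintegral `[0, K] f| <= real_complex R (2 * (B * K)).
Proof.
move=> K0 [f1 f2] fB.
have Rb (g : R -> R) : continuous g -> (forall u, `|g u| <= B) ->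
    `|\int[lebesgue_measure]_(u in `[0, K]) g u| <= B * K.
  move=> gc gB; apply: le_trans (le_normr_Rintegral _ _) _ => //; first exact: itv_integrable.
  have -> : B * K = \int[lebesgue_measure]_(u in `[0, K]) B.
    by rewrite Rintegral_itv_cst.
  apply: le_Rintegral => //; apply: itv_integrable => u; last exact: cvg_cst.
  by apply: cvg_norm; exact: gc.
have nRe (x : R[i]) : `|x| <= real_complex R B -> `|complex.Re x| <= B.
  by move=> h; rewrite -lecR; apply: le_trans h; exact: normc_ge_Re.
have nIm (x : R[i]) : `|x| <= real_complex R B -> `|complex.Im x| <= B.
  rewrite normc_def lecR; apply: le_trans.
  by rewrite -sqrtr_sqr ler_wsqrtr// lerDr sqr_ge0.
rewrite [X in `|X|]complexE; apply: le_trans (ler_normD _ _) _.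
rewrite mulr_natl mulr2n rmorphD /= lerD//.
  rewrite normc_def /= expr0n addr0 sqrtr_sqr lecR.
  by apply: Rb => // u; exact: nRe.
rewrite normrM [`|'i%C|]normc_def /= expr0n expr1n add0r sqrtr1 mul1r.
rewrite normc_def /= expr0n addr0 sqrtr_sqr lecR.
by apply: Rb => // u; exact: nIm.
Qed.

Lemma cis_expz (R : realType) (a : R) (k : int) : cis a ^ k = cis (a * k%:~R).
Proof.
have N (n : nat) : cis a ^+ n = cis (a * n%:R).
  elim: n => [|n IH]; first by rewrite mulr0 cis0.
  by rewrite exprSr IH -cisD -natr1 mulrDr mulr1.
case: k => n; first exact: N.
by rewrite NegzE -exprnN N -cisN mulrNz mulrN.
Qed.

Lemma cis_2pi_int (R : realType) (k : int) : cis (2 * pi * k%:~R : R) = 1.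
Proof.
rewrite -cis_expz (_ : cis _ = 1) ?exp1rz//.
by rewrite mulr_natl /cis cos2pi sin2pi.
Qed.

Lemma Cintegral_cis0 (R : realType) (K a : R) : 0 < K -> a != 0 -> cis (a * K) = 1 ->
  Cintegral `[0, K] (fun u => cis (a * u)) = 0.
Proof.
move=> K0 a0 [ca sa].
have idv (u : R) : is_derive u 1 (fun u : R => a * u) a.
  have := @is_deriveZ R R^o R^o id a u 1 1 (is_derive_id _ _).
  by rewrite /GRing.scale /= mulr1.
have ds (u : R) : is_derive u 1 (fun u : R => a^-1 * sin (a * u)) (cos (a * u)).
  have h := @is_derive1_comp R sin ( *%R a) u _ _ (is_derive_sin (a * u)) (idv u).
  apply: (is_derive_eq (@is_deriveZ R R^o R^o (sin \o *%R a) a^-1 u 1 _ h)).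
  by rewrite /GRing.scale /= mulrC mulfK.
have dc (u : R) : is_derive u 1 (fun u : R => (- a^-1) * cos (a * u)) (sin (a * u)).
  have h := @is_derive1_comp R cos ( *%R a) u _ _ (is_derive_cos (a * u)) (idv u).
  apply: (is_derive_eq (@is_deriveZ R R^o R^o (cos \o *%R a) (- a^-1) u 1 _ h)).
  by rewrite /GRing.scale /= !mulNr mulrN opprK mulrC mulfK.
have FTC (f F : R -> R) : continuous f -> (forall u : R, is_derive u (1 : R) F (f u)) ->
    F K = F 0 -> \int[lebesgue_measure]_(u in `[0, K]) f u = 0.
  move=> fc dF FK; rewrite /Rintegral (@continuous_FTC2 R f F 0 K K0).
  - by rewrite FK subee.
  - exact: continuous_subspaceT.
  - have Fc : continuous F.
      move=> u; apply: differentiable_continuous.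
      by apply/derivable1_diffP; exact: ex_derive.
    split.
    + by move=> x _; exact: ex_derive.
    + by apply: cvg_at_right_filter; exact: Fc.
    + by apply: cvg_at_left_filter; exact: Fc.
  - by move=> x _; rewrite derive1E; exact: derive_val.
have [cc cs] := @ccont_cis R a.
rewrite /Cintegral (FTC _ _ cc ds) ?(FTC _ _ cs dc)// ?mulr0 ?ca ?sa ?sin0 ?cos0//.
Qed.

(** * Integrals with one pole *)

Definition zfun (R : realType) (K u : R) : R[i] := cis (- (2 * pi * u / K)).

Lemma zfun_neq0 (R : realType) (K u : R) : zfun K u != 0.
Proof. exact: cis_neq0. Qed.

Lemma zfun_expz (R : realType) (K u : R) (k : int) :
  zfun K u ^ k = cis (- (2 * pi * k%:~R / K) * u).
Proof. by rewrite cis_expz; congr cis; ring. Qed.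

Lemma ccont_zfun_expz (R : realType) (K : R) (k : int) :
  ccont (fun u => zfun K u ^ k).
Proof. by under eq_fun do rewrite zfun_expz; exact: ccont_cis. Qed.

Lemma Cintegral_zfun (R : realType) (K : R) (k : int) : 0 < K ->
  Cintegral `[0, K] (fun u => zfun K u ^ k) = real_complex R K * (k == 0)%:R.
Proof.
move=> K0; have [->|k0] := eqVneq k 0.
  rewrite (_ : (fun u => _) = fun _ => 1) ?Cintegral_cst//.
rewrite (_ : (fun u => _) = fun u => cis (- (2 * pi * k%:~R / K) * u)); last first.
  by apply/funext => u; rewrite zfun_expz.
rewrite mulr0 Cintegral_cis0//.
  by rewrite oppr_eq0 !mulf_neq0 ?invr_eq0 ?intr_eq0 ?pnatr_eq0// gt_eqF// pi_gt0.
have -> : - (2 * pi * k%:~R / K) * K = 2 * pi * (- k)%:~R.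
  by rewrite mulrNz; field; rewrite gt_eqF.
exact: cis_2pi_int.
Qed.

Definition pole_integral (R : realType) (K : R) (rho : R[i]) (k : int) : R[i] :=
  Cintegral `[0, K] (fun u => zfun K u ^ k / (zfun K u - rho)).

Lemma zfun_sub_neq0 (R : realType) (K u : R) (rho : R[i]) :
  `|rho| != 1 -> zfun K u - rho != 0.
Proof.
by move=> h; rewrite subr_eq0; apply: contra h => /eqP <-; rewrite norm_cis.
Qed.

Lemma ccont_pole (R : realType) (K : R) (rho : R[i]) (k : int) : `|rho| != 1 ->
  ccont (fun u => zfun K u ^ k / (zfun K u - rho)).
Proof.
move=> h; apply: ccontM; first exact: ccont_zfun_expz.
apply: ccontV => [|u]; last exact: zfun_sub_neq0.
by apply: ccontD; [exact: (@ccont_zfun_expz _ K 1) | exact: ccont_cst].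
Qed.

Lemma pole_integral_rec (R : realType) (K : R) (rho : R[i]) (k : int) :
  0 < K -> `|rho| != 1 ->
  pole_integral K rho (k + 1) =
    rho * pole_integral K rho k + real_complex R K * (k == 0)%:R.
Proof.
move=> K0 h; rewrite /pole_integral -(Cintegral_zfun k K0).
rewrite -CintegralZ; last exact: ccont_pole.
rewrite -CintegralD; last exact: ccont_zfun_expz.
  congr Cintegral; apply/funext => u.
  have z0 := zfun_neq0 K u; have d0 := zfun_sub_neq0 K u h.
  by rewrite expfzDr// expr1z; move: (zfun K u ^ k) => y; field.
by apply: ccontM; [exact: ccont_cst | exact: ccont_pole].
Qed.

(** On the circle |z^k| = 1, and |z - rho| is at least the distance [d] of |rho| from 1, so the
    bound is independent of k. *)
Lemma pole_integral_bound (R : realType) (K : R) (rho : R[i]) :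
  0 < K -> `|rho| != 1 ->
  exists B : R, forall k : int, `|pole_integral K rho k| <= real_complex R B.
Proof.
move=> K0 h.
pose d := `|1 - ComplexField.Normc.normc rho|.
have dE : real_complex R d = `|1 - `|rho| |.
  rewrite -[`|rho|]/(real_complex R (ComplexField.Normc.normc rho)).
  by rewrite -(rmorph1 (real_complex R)) -rmorphB normc_def /= expr0n addr0 sqrtr_sqr.
have d0 : 0 < d.
  by rewrite -ltcR dE normr_gt0 subr_eq0 eq_sym.
exists (2 * (d^-1 * K)) => k.
apply: Cintegral_bound => //; first exact: ccont_pole.
move=> u; rewrite normrM normfV zfun_expz norm_cis mul1r fmorphV /=.
rewrite lef_pV2 ?posrE ?normr_gt0 ?zfun_sub_neq0//; last by rewrite ltcR.
rewrite dE -(norm_cis (- (2 * pi * u / K))); exact: ler_dist_dist.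
Qed.

(** Turns a homogeneous recurrence, iterated in the direction in which it gains a factor [r], into
    vanishing. *)
Lemma bounded_geometric_eq0 (R : realType) (x r : R[i]) (B : R) : `|r| < 1 ->
  (forall n : nat, exists2 y, x = r ^+ n * y & `|y| <= real_complex R B) -> x = 0.
Proof.
move=> r1 H; apply/eqP; rewrite -normr_eq0.
pose t := ComplexField.Normc.normc r; pose d := ComplexField.Normc.normc x.
have t1 : t < 1 by rewrite -ltcR.
have t0 : 0 <= t by rewrite -ler0c; exact: (normr_ge0 r).
have d0 : 0 <= d by rewrite -ler0c; exact: (normr_ge0 x).
have dB n : d <= geometric B t n.
  have [y xE yB] := H n.
  rewrite -lecR /geometric/= rmorphM rmorphXn/= mulrC.
  rewrite -[real_complex R d]/`|x| xE normrM normrX.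
  by rewrite ler_wpM2l// exprn_ge0.
have cg : geometric B t @ \oo --> (0 : R).
  by apply: cvg_geometric; rewrite ger0_norm.
have d1 : d <= 0.
  apply: (ler_cvg_to (cvg_cst d) cg); near=> n; exact: dB.
have d00 : d = 0 by apply/eqP; rewrite eq_le d1.
by rewrite -[`|x|]/(real_complex R d) d00.
Unshelve. all: by end_near. Qed.

(** Going down, J_(-n) = rho^m J_(-n-m) for all m, hence 0; the source term at k = 0 then starts J_1
    = K, J_2 = K rho and so on. *)
Lemma pole_integral_inside (R : realType) (K : R) (rho : R[i]) :
  0 < K -> `|rho| < 1 -> forall n : nat,
  pole_integral K rho (- n%:Z) = 0 /\
  pole_integral K rho n.+1%:Z = real_complex R K * rho ^+ n.
Proof.
move=> K0 r1; have h : `|rho| != 1 by rewrite lt_eqF.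
have [B HB] := pole_integral_bound K0 h.
have neg n : pole_integral K rho (- n%:Z) = 0.
  apply: (bounded_geometric_eq0 (B := B) r1) => m.
  exists (pole_integral K rho (- (n + m)%N%:Z)); last exact: HB.
  elim: m => [|m IH]; first by rewrite addn0 expr0 mul1r.
  rewrite IH exprSr -mulrA; congr (_ * _).
  have -> : - (n + m)%N%:Z = - (n + m.+1)%N%:Z + 1 by lia.
  rewrite (pole_integral_rec _ K0 h) (_ : (_ == 0) = false) ?mulr0 ?addr0//.
  by apply/eqP; lia.
move=> n; split; first exact: neg.
elim: n => [|n IH].
  rewrite -[1%:Z]add0r (pole_integral_rec _ K0 h) eqxx expr0.
  by rewrite -[in pole_integral _ _ 0]oppr0 (neg 0%N) mulr0 add0r.
have -> : n.+2%:Z = n.+1%:Z + 1 by lia.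
by rewrite (pole_integral_rec _ K0 h) IH mulr0 addr0 mulrCA exprS.
Qed.

(** Going up, J_(n+1) = r^m J_(n+1+m) for all m, hence 0; the source term then forces J_0 = -K r,
    and each step down adds a factor r. *)
Lemma pole_integral_outside (R : realType) (K : R) (r : R[i]) :
  0 < K -> r != 0 -> `|r| < 1 -> forall n : nat,
  pole_integral K r^-1 n.+1%:Z = 0 /\
  pole_integral K r^-1 (- n%:Z) = - (real_complex R K * r ^+ n.+1).
Proof.
move=> K0 r0 r1; have h : `|r^-1| != 1.
  by rewrite normfV invr_eq1 lt_eqF.
have [B HB] := pole_integral_bound K0 h.
have pos n : pole_integral K r^-1 n.+1%:Z = 0.
  apply: (bounded_geometric_eq0 (B := B) r1) => m.
  exists (pole_integral K r^-1 (n.+1 + m)%N%:Z); last exact: HB.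
  elim: m => [|m IH]; first by rewrite addn0 expr0 mul1r.
  rewrite IH exprSr -mulrA; congr (_ * _).
  have -> : (n.+1 + m.+1)%N%:Z = (n.+1 + m)%N%:Z + 1 by lia.
  rewrite (pole_integral_rec _ K0 h) (_ : (_ == 0) = false) ?mulr0 ?addr0//.
    by rewrite mulrA mulfV// mul1r.
move=> n; split; first exact: pos.
elim: n => [|n IH].
  have := pole_integral_rec 0 K0 h; rewrite add0r (pos 0%N) eqxx mulr1 => /eqP.
  rewrite eq_sym addr_eq0 => /eqP E; rewrite oppr0 expr1.
  by rewrite -[LHS](mulKf (invr_neq0 r0)) E invrK mulrN mulrC.
have := pole_integral_rec (- n.+1%:Z) K0 h.
have -> : - n.+1%:Z + 1 = - n%:Z by lia.
rewrite IH (_ : (_ == 0) = false) ?mulr0 ?addr0// => E.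
by rewrite -[LHS](mulKf (invr_neq0 r0)) -E invrK mulrN mulrCA -exprS.
Qed.

(** * Partial fractions *)

Lemma deriv_prod_root (F : fieldType) (I : finType) (rho : I -> F) (c : F) (i : I) :
  (c *: \prod_j ('X - (rho j)%:P))^`().[rho i] =
  c * \prod_(j | j != i) (rho i - rho j).
Proof.
rewrite (bigD1 i)//= derivZ derivM derivXsubC mul1r hornerZ hornerD hornerM hornerXsubC.
rewrite subrr mul0r addr0 horner_prod; congr (_ * _); apply: eq_bigr => j _.
by rewrite hornerXsubC.
Qed.

(** Lagrange interpolation of the constant 1: [H] has size at most #|I| and vanishes at every root.
    Non-zero derivatives make the roots distinct, and [i0] excludes the empty product. *)
Lemma partial_fractions (F : fieldType) (I : finType) (i0 : I) (rho : I -> F) (c : F) :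
  let P := c *: \prod_j ('X - (rho j)%:P) in
  (forall i, P^`().[rho i] != 0) -> forall z : F, (forall i, z - rho i != 0) ->
  P.[z]^-1 = \sum_i (P^`().[rho i])^-1 / (z - rho i).
Proof.
move=> P P'0 z z0.
have c0 : c != 0.
  by apply: contra_neq (P'0 i0) => c0; rewrite /P c0 scale0r deriv0 horner0.
have inj : injective rho.
  move=> i j rij; apply/eqP/negPn/negP => ij.
  have := P'0 i; rewrite deriv_prod_root mulf_eq0 (negbTE c0)/= => /prodf_neq0 /(_ j).
  by rewrite eq_sym ij rij subrr eqxx => /(_ isT).
pose L i : {poly F} := \prod_(j | j != i) ('X - (rho j)%:P).
pose H := \sum_i (P^`().[rho i])^-1 *: (c *: L i) - 1.
have H0 : H = 0.
  apply/eqP/negPn/negP => H0.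
  have := @max_poly_roots _ _ [seq rho i | i <- enum I] H0.
  rewrite size_map -cardE => h.
  suff : (#|I| < #|I|)%N by rewrite ltnn.
  apply: leq_trans (h _ _) _.
  - apply/allP => _ /mapP[i _ ->]; rewrite /root /H hornerD hornerN hornerC.
    rewrite horner_sum (bigD1 i)//= big1 ?addr0.
      rewrite !hornerZ horner_prod (eq_bigr (fun j => rho i - rho j)).
        by rewrite -deriv_prod_root mulVf ?subrr.
      by move=> j _; rewrite hornerXsubC.
    move=> j ji; rewrite !hornerZ horner_prod (bigD1 i) 1?eq_sym//=.
    by rewrite hornerXsubC subrr mul0r !mulr0.
  - by rewrite map_inj_uniq ?enum_uniq.
  have Ipos : (0 < #|I|)%N by apply/card_gt0P; exists i0.
  apply: leq_trans (size_polyD _ _) _; rewrite geq_max size_polyN size_poly1 Ipos andbT.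
  apply: leq_trans (size_sum _ _ _) _; apply/bigmax_leqP => i _.
  apply: leq_trans (size_scale_leq _ _) _; apply: leq_trans (size_scale_leq _ _) _.
  rewrite size_prod => [|j _]; last by rewrite polyXsubC_eq0.
  under eq_bigr do rewrite size_XsubC.
  rewrite sum_nat_const muln2 -addnn -addSn addnK.
  by rewrite -(prednK Ipos) ltnS -(cardC1 i); apply: eq_leq; apply: eq_card.
have Pz : P.[z] != 0.
  rewrite hornerZ mulf_neq0// horner_prod; apply/prodf_neq0 => i _.
  by rewrite hornerXsubC.
have : H.[z] = 0 by rewrite H0 horner0.
rewrite /H hornerD hornerN hornerC => /eqP; rewrite subr_eq0 => /eqP E.
rewrite -[LHS]mul1r -E horner_sum mulr_suml; apply: eq_bigr => i _.
rewrite !hornerZ -mulrA; congr (_ * _).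
rewrite (bigD1 i)//= hornerM hornerXsubC -/(L i).
have Lz : (L i).[z] != 0.
  by rewrite horner_prod; apply/prodf_neq0 => j _; rewrite hornerXsubC.
by field; rewrite c0 Lz z0.
Qed.

(** * Exponential splines *)

(** Since (1 - z^-1)^p / (z - 1)^j = z^-p (z - 1)^(p-j), Phi_p(t, z) is z^(floor t - p) times this
    polynomial with a = {t}; this also covers z = 1. *)
Definition Phi_poly (R : realType) (Pi : nat -> {poly R}) (p : nat) (a : R) : {poly R} :=
  \sum_(j < p.+1) ('C(p, j)%:R * a ^+ (p - j) / p`!%:R) *:
    (Pi j * ('X - 1) ^+ (p - j)).

Lemma Phi_polyE (R : realType) (Pi : nat -> {poly R}) (p : nat) (t : R) (z : R[i]) :
  euler_frobenius Pi -> z != 0 ->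
  Phi Pi p t z =
    z ^ (Num.floor t - p%:Z) * (polyC_of (Phi_poly Pi p (frac_part t))).[z].
Proof.
move=> hPi z0; have f0 : p`!%:R != 0 :> R[i] by rewrite pnatr_eq0 -lt0n fact_gt0.
have PE : (polyC_of (Phi_poly Pi p (frac_part t))).[z] = \sum_(j < p.+1)
    'C(p, j)%:R * real_complex R (frac_part t) ^+ (p - j) / p`!%:R *
    ((polyC_of (Pi j)).[z] * (z - 1) ^+ (p - j)).
  rewrite /polyC_of /Phi_poly rmorph_sum horner_sum /=; apply: eq_bigr => j _.
  rewrite map_polyZ hornerZ !(rmorphM, rmorphXn, rmorphB, rmorph1, fmorphV, rmorph_nat) /=.
  by rewrite map_polyX !(hornerM, hornerD, hornerN, horner_exp, hornerX, hornerC).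
rewrite PE /Phi; case: eqP => [->|/eqP z1].
  rewrite exp1rz mul1r big_ord_recr/= big1 => [|j _].
    rewrite subnn !expr0 binn -[X in _.[X]](rmorph1 (real_complex R)) horner_map/=.
    by rewrite (euler_frobenius_at1 hPi) rmorph_nat add0r !mulr1 mul1r mulVf.
  rewrite subrr expr0n; have := ltn_ord j.
  by rewrite ltnNge -subn_eq0 => /negbTE ->; rewrite !mulr0.
have zm : z - 1 != 0 by rewrite subr_eq0.
rewrite expfzDr// -mulrA -[RHS]mulrA; congr (_ * _); rewrite !mulr_sumr.
apply: eq_bigr => -[j /= jp] _.
have -> : 1 - z^-1 = (z - 1) / z by field.
rewrite expr_div_n -exprnN -[in (z - 1) ^+ p](subnK (_ : j <= p)%N)// exprD.
have zj : (z - 1) ^+ j != 0 by rewrite expf_neq0.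
have zp : z ^+ p != 0 by rewrite expf_neq0.
move: (_.[z]) ((z - 1) ^+ (p - j)) ((z - 1) ^+ j) zj (z ^+ p) zp => A B C C0 D D0.
move: (_ ^+ (p - j)) => E.
by field; rewrite f0 C0 D0.
Qed.

Lemma size_Phi_poly (R : realType) (Pi : nat -> {poly R}) (p : nat) (a : R) :
  euler_frobenius Pi -> (size (Phi_poly Pi p a) <= p.+1)%N.
Proof.
move=> [Pi0 sPi _]; apply: leq_trans (size_sum _ _ _) _; apply/bigmax_leqP => -[j jp] _ /=.
apply: leq_trans (size_scale_leq _ _) _.
have sX : size (('X - 1 : {poly R}) ^+ (p - j)) = (p - j).+1.
  by rewrite -[1]/(1%:P) size_exp_XsubC.
case: j jp sX => [|j] jp sX; first by rewrite Pi0 mul1r sX subn0.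
apply: leq_trans (size_polyMleq _ _) _; rewrite sX sPi//.
by rewrite addnS/= subnKC// ltnW.
Qed.

Lemma horner_rev (F : fieldType) (p : nat) (q : {poly F}) (z : F) :
  (size q <= p.+1)%N -> z != 0 ->
  z ^+ p * q.[z^-1] = (\poly_(i < p.+1) q`_(p - i)).[z].
Proof.
move=> sq z0; rewrite horner_poly (horner_coef_wide _ sq) mulr_sumr.
rewrite (reindex_inj rev_ord_inj); apply: eq_bigr => -[i /= ip] _.
rewrite subSS; have ip' : (i <= p)%N by [].
rewrite mulrCA; congr (_ * _).
by rewrite -{1}(subnK ip') exprD exprVn mulrAC mulfV ?expf_neq0// mul1r.
Qed.

Lemma floor_addz (R : realType) (t : R) (m : int) :
  Num.floor (t + m%:~R) = Num.floor t + m.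
Proof. by rewrite floorDrz ?intrKfloor// intr_int. Qed.

Lemma frac_part_addz (R : realType) (t : R) (m : int) :
  frac_part (t + m%:~R) = frac_part t.
Proof. by rewrite /frac_part floor_addz rmorphD /=; ring. Qed.

Lemma frac_part_frac_add (R : realType) (t c : R) :
  frac_part (frac_part t + c) = frac_part (t + c).
Proof.
rewrite -(frac_part_addz (frac_part t + c) (Num.floor t)); congr frac_part.
by rewrite /frac_part; ring.
Qed.

(** (p+1)/2 and -{(p+1)/2} differ by the integer p + 1 - floor((p+1)/2), which cancels in the
    difference of floors. *)
Lemma dxtE (R : realType) (p K : nat) (x t : R) :
  dxt p K x t = Num.floor (K%:R * x + p.+1%:R / 2) - Num.floor (K%:R * t + p.+1%:R / 2).
Proof.
have E (y : R) : y + p.+1%:R / 2 =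
    y - frac_part (p.+1%:R / 2) + (p.+1%:Z - Num.floor (p.+1%:R / 2 : R))%:~R.
  by rewrite /frac_part rmorphB /=; field.
by rewrite /dxt (E (K%:R * x)) (E (K%:R * t)) !floor_addz; ring.
Qed.

(** The powers of z multiply to z^p, which turns the second spline polynomial at z^-1 into its
    reversal; the alpha_l are coefficients of the product. They depend only on {Kx} and {Kt} because
    {Kx + c} = {{Kx} + c}. *)
Lemma represents_exists (R : realType) (Pi : nat -> {poly R}) (p K : nat) :
  euler_frobenius Pi ->
  exists alpha : 'I_(2 * p).+1 -> R -> R -> R[i], represents Pi K alpha.
Proof.
move=> hPi; pose c : R := p.+1%:R / 2.
pose A (a : R) := polyC_of (Phi_poly Pi p (frac_part (a + c))).
exists (fun l a b => (A a * \poly_(i < p.+1) (A b)`_(p - i))`_l) => x t z z0.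
have zV0 : z^-1 != 0 by rewrite invr_eq0.
have sA a : (size (A a) <= p.+1)%N.
  by rewrite /A /polyC_of (leq_trans (size_poly _ _))// size_Phi_poly.
rewrite -horner_coef_wide; last first.
  apply: leq_trans (size_polyMleq _ _) _.
  rewrite -subn1 leq_subLR; apply: leq_trans (leq_add (sA _) (size_poly _ _)) _.
  by lia.
rewrite hornerM -horner_rev//.
rewrite !(@Phi_polyE _ _ _ _ _ hPi)// /A !frac_part_frac_add dxtE -/c.
rewrite exprz_inv; set f := Num.floor _; set g := Num.floor _.
rewrite mulrACA !mulrA -!expfzDr//.
have -> : p%:Z - (f - g) - (g - p%:Z) + (f - p%:Z) = p%:Z by ring.
by rewrite -exprnP [z ^+ p * _]mulrC.
Qed.

(** * The equivalent kernel *)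

(** The polynomial factor of Phi has real coefficients, and conjugation on the unit circle is
    inversion. *)
Lemma Phi_conj (R : realType) (Pi : nat -> {poly R}) (p : nat) (t : R) (a : R) :
  euler_frobenius Pi ->
  conjc (Phi Pi p t (cis a)) = Phi Pi p t (cis a)^-1.
Proof.
move=> hPi; rewrite !Phi_polyE ?invr_eq0 ?cis_neq0// rmorphM /=.
rewrite -conjc_cis (fmorphXz (conjc : {rmorphism R[i] -> R[i]})) /=; congr (_ * _).
rewrite -(horner_map (conjc : {rmorphism R[i] -> R[i]})) /=.
rewrite /polyC_of -map_poly_comp; congr (_.[_]).
by apply: eq_map_poly => y /=; rewrite oppr0.
Qed.

(** The l = 0 term is positive unless v = 1, where the l = -1 term equals 1. *)
Lemma Q_gt0 (R : realType) (k : nat) (v : R) : 0 <= v <= 1 -> 0 < Q (2 * k) v.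
Proof.
move=> v01; have v01' : 0 <= 1 - v <= 1 by lra.
have pos (y : R) : 0 <= y <= 1 -> y != 1 -> 0 < sinc (pi * y) ^+ (2 * k + 2).
  move=> /andP[y0 y1] yn1; apply: exprn_gt0; rewrite /sinc; case: ifPn => // py.
  have p0 := pi_gt0 R.
  have ys : 0 < y.
    by rewrite lt_neqAle y0 andbT eq_sym; apply: contra py => /eqP ->; rewrite mulr0.
  have yl : y < 1 by rewrite lt_neqAle yn1.
  by rewrite divr_gt0 ?mulr_gt0// sin_gt0_pi// mulr_gt0//= gtr_pMr.
rewrite Q_sinc_sum.
have /andP[a _] := sinc_sum_bounds k v01; have /andP[b _] := sinc_sum_bounds k v01'.
have [v1|v1] := eqVneq v 1.
  apply: (@lt_le_trans _ _ (sinc (pi * (1 - v)) ^+ (2 * k + 2))).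
    by apply: pos => //; rewrite v1 subrr eq_sym oner_eq0.
  by rewrite (le_trans b)// lerDr (le_trans _ a)// sinc_term_ge0.
apply: lt_le_trans (pos v v01 v1) _.
by rewrite (le_trans a)// lerDl (le_trans _ b)// sinc_term_ge0.
Qed.

Lemma mu_ge0 (R : realType) (p q K : nat) (u : R) : (q <= p)%N ->
  0 <= u / K%:R <= 1 -> 0 <= mu p q K u.
Proof.
move=> qp v01; rewrite /mu -mulnBr.
have ev (x : R) : 0 <= x ^+ (2 * q) by rewrite exprM exprn_ge0// sqr_ge0.
by rewrite !mulr_ge0 ?ev ?invr_ge0// ltW// Q_gt0.
Qed.

(** With y = pi u / K, 2 pi u sinc(y) = 2K sin(y) and 4 sin^2(y) = -(1 - z)^2 / z. The q-th power of
    the latter yields the sign (-1)^q, the factor (1 - z)^(2q), and the z^-q that completes the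
    z^-(p-q) of Q_(2p-2q) to z^-p. *)
Lemma symbol_P2p (R : realType) (Pi : nat -> {poly R}) (p q K : nat) (lambda u : R) :
  euler_frobenius Pi -> (0 < K)%N -> (q <= p)%N -> (0 < q)%N ->
  0 <= u / K%:R <= 1 ->
  real_complex R (Q (2 * p) (u / K%:R) * (1 + lambda * mu p q K u)) =
  zfun K%:R u ^- p * (P2p Pi p q K lambda).[zfun K%:R u].
Proof.
move=> hPi K0 qp q0 v01; have Qp := Q_gt0 p v01.
have K0' : K%:R != 0 :> R by rewrite pnatr_eq0 -lt0n.
set z := zfun _ _.
have zE : zarg (u / K%:R) = z by rewrite /zarg /z /zfun mulrA.
have z0 : z != 0 by exact: zfun_neq0.
have PE : (P2p Pi p q K lambda).[z] =
    (polyC_of (Pi (2 * p).+1)).[z] / ((2 * p).+1)`!%:R +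
    (-1) ^+ q * real_complex R lambda * K%:R ^+ (2 * q) / ((2 * (p - q)).+1)`!%:R *
    ((1 - z) ^+ (2 * q) * (polyC_of (Pi (2 * (p - q)).+1)).[z]).
  rewrite /P2p mulnBr /polyC_of; set m := (2 * p - 2 * q)%N.
  rewrite [map_poly _ (_ + _)]rmorphD /= !map_polyZ hornerD !hornerZ.
  rewrite [map_poly _ (_ * _)]rmorphM /= hornerM [map_poly _ (_ ^+ _)]rmorphXn /= horner_exp.
  rewrite [map_poly _ (1 - _)]rmorphB rmorph1 /= map_polyX !(hornerD, hornerN, hornerX, hornerC).
  rewrite !(fmorphV, rmorphM, rmorphXn, rmorphN1, rmorph_nat) /=.
  by congr (_ + _); rewrite mulrC.
set y := pi * u / K%:R.
have ySin : (2 * pi * u) ^+ (2 * q) * sinc y ^+ (2 * q) =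
    K%:R ^+ (2 * q) * (4 * sin y ^+ 2) ^+ q.
  rewrite -exprMn; have -> : 2 * pi * u = 2 * K%:R * y by rewrite /y; field.
  have -> : 2 * K%:R * y * sinc y = K%:R * (2 * sin y).
    rewrite /sinc; case: eqP => [->|/eqP y0]; first by rewrite sin0; ring.
    by field.
  by rewrite exprMn [(2 * sin y) ^+ _]exprM; congr (_ * _ ^+ _); ring.
have sinE : real_complex R (4 * sin y ^+ 2) = - ((1 - z) ^+ 2 / z).
  have zc : z = cis (- y) * cis (- y) by rewrite -cisD /z /zfun /y; congr cis; field.
  have e0 := cis_neq0 (- y).
  have -> : 1 - z = - cis (- y) * (cis (- y) - (cis (- y))^-1).
    by rewrite mulrBr mulNr -zc mulNr mulfV// opprK addrC.
  rewrite cis_subV sinN zc.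
  have -> : real_complex R (4 * sin y ^+ 2) = 4 * real_complex R (sin y) ^+ 2.
    by rewrite rmorphM rmorphXn rmorph_nat.
  rewrite rmorphN /=; move: (sqr_i R) e0; move: 'i%C (cis (- y)) => I e I2 e0.
  have -> : 4 * real_complex R (sin y) ^+ 2 = - I ^+ 2 * (4 * real_complex R (sin y) ^+ 2).
    by rewrite I2 opprK mul1r.
  by field.
have -> : Q (2 * p) (u / K%:R) * (1 + lambda * mu p q K u) =
   Q (2 * p) (u / K%:R) + lambda * K%:R ^+ (2 * q) *
     ((4 * sin y ^+ 2) ^+ q * Q (2 * (p - q)) (u / K%:R)).
  by rewrite /mu ySin mulnBr; field; rewrite gt_eqF.
rewrite rmorphD !rmorphM [X in _ + _ * (X * _)]rmorphXn /=.
rewrite sinE !(Q_EF_symbol hPi)// zE /EF_symbol.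
rewrite PE mulrDr; congr (_ + _).
have -> : z ^- p = z ^- q * z ^- (p - q) by rewrite -invfM -exprD subnKC.
have -> : (- ((1 - z) ^+ 2 / z)) ^+ q = (-1) ^+ q * (1 - z) ^+ (2 * q) * z ^- q.
  by rewrite exprNn expr_div_n -exprM mulrA.
by rewrite rmorphXn rmorph_nat /=; ring.
Qed.

(** Each of the p - 1 other pairs satisfies (1/r - s)(1/r - 1/s) = r^-2 (r - s)(r - 1/s), while the
    derivative 2x - r - 1/r of the pair's own factor changes sign between r and 1/r. *)
Lemma deriv_reciprocal_roots (F : fieldType) (p : nat) (r : 'I_p -> F) (c : F) (j : 'I_p) :
  let P := c *: \prod_(k < p) (('X - (r k)%:P) * ('X - ((r k)^-1)%:P)) in
  (forall k, r k != 0) ->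
  P^`().[(r j)^-1] = - (r j ^- (2 * p - 2) * P^`().[r j]).
Proof.
move=> P r0; pose G := \prod_(k < p | k != j) (('X - (r k)%:P) * ('X - ((r k)^-1)%:P)).
have dP x : x = r j \/ x = (r j)^-1 ->
    P^`().[x] = c * ((x + x - r j - (r j)^-1) * G.[x]).
  move=> xE; rewrite /P (bigD1 j)//= -/G derivZ hornerZ !derivM !derivXsubC.
  rewrite !(hornerD, hornerM, hornerN, hornerX, hornerC) mul1r mulr1.
  congr (_ * _); case: xE => ->; ring.
have GE : G.[(r j)^-1] = r j ^- (2 * p - 2) * G.[r j].
  have -> : r j ^- (2 * p - 2) = \prod_(k < p | k != j) (r j ^- 2).
    rewrite prodr_const (_ : #|_| = p.-1).
      by rewrite -exprVn -exprVn -exprM; congr (_ ^+ _); lia.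
    by have := cardC1 j; rewrite card_ord => <-; apply: eq_card.
  rewrite /G !horner_prod -big_split; apply: eq_bigr => k _ /=.
  rewrite !(hornerD, hornerM, hornerN, hornerX, hornerC).
  by field; rewrite !r0.
rewrite !dP ?GE; [ring | by left | by right].
Qed.

Lemma W_integrand (R : realType) (Pi : nat -> {poly R}) (p q K : nat)
    (lambda : R) (alpha : 'I_(2 * p).+1 -> R -> R -> R[i]) (x t u : R) :
  euler_frobenius Pi -> (0 < q)%N -> (0 < K)%N -> (q <= p)%N -> 0 <= lambda ->
  represents Pi K alpha -> 0 <= u / K%:R <= 1 ->
  phi Pi p K u x * conjc (phi Pi p K u t) / real_complex R (1 + lambda * mu p q K u) =
  \sum_(l < (2 * p).+1) alpha l (frac_part (K%:R * x)) (frac_part (K%:R * t)) *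
    (zfun K%:R u ^ (dxt p K x t + l%:Z) / (P2p Pi p q K lambda).[zfun K%:R u]).
Proof.
move=> hPi q0 K0 qp l0 hal v01.
set z := zfun K%:R u; have z0 : z != 0 by exact: zfun_neq0.
have Qp := Q_gt0 p v01; have m0 := mu_ge0 qp v01.
have d0 : 0 < 1 + lambda * mu p q K u by rewrite ltr_pwDl// mulr_ge0.
have := symbol_P2p lambda hPi K0 qp q0 v01; rewrite -/z => E.
have Qd : real_complex R (Q (2 * p) (u / K%:R) * (1 + lambda * mu p q K u)) != 0.
  by rewrite (fmorph_eq0 (real_complex R)) mulf_neq0// gt_eqF.
pose s := Num.sqrt (Q (2 * p) (u / K%:R)).
have ss : real_complex R s * real_complex R s = real_complex R (Q (2 * p) (u / K%:R)).
  by rewrite -rmorphM -expr2 sqr_sqrtr// ltW.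
have cs (A : R[i]) : conjc (A / real_complex R s) = conjc A / real_complex R s.
  by rewrite rmorphM fmorphV /= oppr0.
rewrite /phi -/(zfun _ _) -/z -/s cs [in conjc _]/z /zfun Phi_conj// -/(zfun _ _) -/z.
(* The positive quantity Q_2p (1 + lambda mu) keeps [P2p] from vanishing on the circle. *)
have P0 : (P2p Pi p q K lambda).[z] != 0.
  by apply: contra_neq Qd => P0; rewrite E P0 mulr0.
transitivity (z ^ (dxt p K x t - p%:Z) *
    (z ^ (p%:Z - dxt p K x t) * Phi Pi p (K%:R * x + p.+1%:R / 2) z *
     Phi Pi p (K%:R * t + p.+1%:R / 2) z^-1) /
    real_complex R (Q (2 * p) (u / K%:R) * (1 + lambda * mu p q K u))).
  rewrite rmorphM /= -ss.
  move: (Phi _ _ _ z) (Phi _ _ _ z^-1) (real_complex R s) (real_complex R (1 + _)).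
  move=> A B S D; rewrite !mulrA -expfzDr//.
  rewrite (_ : dxt p K x t - p%:Z + (p%:Z - dxt p K x t) = 0); last by ring.
  by rewrite expr0z mul1r !invfM; ring.
rewrite hal// E mulr_sumr mulr_suml; apply: eq_bigr => l _.
rewrite invfM invrK !(expfzDr _ _ z0) -exprnN -exprnP.
have zp : z ^+ p != 0 by rewrite expf_neq0.
by move: (z ^ dxt p K x t) (z ^+ l) => A B; field; rewrite P0 zp.
Qed.

Theorem lemma2 (R : realType) (Pi : nat -> {poly R})
    (hPi : euler_frobenius Pi)
    (p q K : nat) (hp : (0 < p)%N) (hq : (0 < q)%N) (hK : (0 < K)%N)
    (hqp : (q <= p)%N)
    (lambda : R) (hlambda : 0 <= lambda)
    (hdeg : size (P2p Pi p q K lambda) = (2 * p).+1)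
    (r : 'I_p -> R[i])
    (hroots : P2p Pi p q K lambda =
       lead_coef (P2p Pi p q K lambda) *:
         \prod_(j < p) (('X - (r j)%:P) * ('X - ((r j)^-1)%:P)))
    (hr : forall j : 'I_p, `|r j| < 1)
    (hP' : forall j : 'I_p, (P2p Pi p q K lambda)^`().[r j] != 0) :
  (exists alpha : 'I_(2 * p).+1 -> R -> R -> R[i], represents Pi K alpha) /\
  (forall alpha : 'I_(2 * p).+1 -> R -> R -> R[i], represents Pi K alpha ->
     forall x t : R,
       W Pi p q K lambda x t =
       K%:R * \sum_(j < p) \sum_(l < (2 * p).+1)
         alpha l (frac_part (K%:R * x)) (frac_part (K%:R * t))
           / (P2p Pi p q K lambda)^`().[r j]
         * r j ^+ (absz (dxt p K x t + l%:Z - 1)%R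
                    + (2 * p - 2) * (dxt p K x t + l%:Z <= 0)%R)%N).
Proof.
split=> [|alpha hal x t]; first exact: represents_exists.
set P := P2p _ _ _ _ _ in hroots hP' *; set c := lead_coef P in hroots.
have K0 : 0 < K%:R :> R by rewrite ltr0n.
pose rho (i : 'I_p + 'I_p) := match i with inl j => r j | inr j => (r j)^-1 end.
have PE : P = c *: \prod_i ('X - (rho i)%:P).
  by rewrite hroots big_sumType /= big_split.
(* As 0^-1 = 0 here, r_j = 0 would occur twice among the [rho], a double root, against [hP']. *)
have r0 j : r j != 0.
  apply: contra_neq (hP' j) => rj0.
  rewrite PE -[r j]/(rho (inl j)) deriv_prod_root (bigD1 (inr j))//= rj0 invr0 subrr.
  by rewrite mul0r mulr0.
have dV j : P^`().[(r j)^-1] = - (r j ^- (2 * p - 2) * P^`().[r j]).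
  by rewrite hroots; exact: deriv_reciprocal_roots.
have dP i : P^`().[rho i] != 0.
  case: i => j /=; first exact: hP'.
  by rewrite dV oppr_eq0 mulf_neq0// invr_eq0 expf_neq0.
have rho1 i : `|rho i| != 1.
  by case: i => j /=; rewrite ?normfV ?invr_eq1 lt_eqF.
have pf u : P.[zfun K%:R u]^-1 = \sum_i (P^`().[rho i])^-1 / (zfun K%:R u - rho i).
  have [j0] : exists j : 'I_p, true by exists (Ordinal hp).
  move=> _; rewrite {1}PE; rewrite (partial_fractions (inl j0 : 'I_p + 'I_p)).
  - by rewrite -PE.
  - by rewrite -PE.
  - by move=> i; exact: zfun_sub_neq0.
pose a l := alpha l (frac_part (K%:R * x)) (frac_part (K%:R * t)).
pose d := dxt p K x t.
have -> : W Pi p q K lambda x t =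
    \sum_(l < (2 * p).+1) \sum_i a l / P^`().[rho i] * pole_integral K%:R (rho i) (d + l%:Z).
  rewrite /W (@eq_Cintegral _ _ _ (fun u => \sum_(l < (2 * p).+1) \sum_i
    a l / P^`().[rho i] * (zfun K%:R u ^ (d + l%:Z) / (zfun K%:R u - rho i)))).
    rewrite Cintegral_sum => [|l].
      apply: eq_bigr => l _; rewrite Cintegral_sum => [|i].
        by apply: eq_bigr => i _; rewrite CintegralZ//; exact: ccont_pole.
      by apply: ccontM; [exact: ccont_cst | exact: ccont_pole].
    apply: ccont_sum => i.
    by apply: ccontM; [exact: ccont_cst | exact: ccont_pole].
  move=> u; rewrite inE /= in_itv /= => /andP[u0 u1].
  have v01 : 0 <= u / K%:R <= 1.
    by rewrite divr_ge0 ?(ltW K0)//= ler_pdivrMr// mul1r.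
  rewrite (W_integrand x t hPi hq hK hqp hlambda hal v01) -/P.
  apply: eq_bigr => l _; rewrite -/(a l) -/d pf !mulr_sumr; apply: eq_bigr => i _.
  ring.
rewrite exchange_big big_sumType /= -big_split mulr_sumr; apply: eq_bigr => j _ /=.
rewrite -big_split mulr_sumr; apply: eq_bigr => l _ /=.
rewrite -/(a l) -/d.
have KE : real_complex R K%:R = K%:R :> R[i] by rewrite rmorph_nat.
rewrite dV; have nP := hP' j; have nr : r j ^+ (2 * p - 2) != 0 by rewrite expf_neq0.
(* Write k = d + l. For k <= 0 only the outer pole contributes: its -K r^(|k|+1) and the factor
   -r^(2p-2) from 1 / P'(1/r) give K r^(|k-1|+2p-2) / P'(r). For k >= 1 only the inner pole does,
   with K r^(k-1) / P'(r). *)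
case: (d + l%:Z) => [[|n]|n].
- have [_ ->] := pole_integral_outside K0 (r0 j) (hr j) 0.
  have [-> _] := pole_integral_inside K0 (hr j) 0.
  rewrite KE lexx muln1 exprD mulr0 add0r /=.
  by move: (r j ^+ (2 * p - 2)) nr => y nr; field; rewrite nr nP.
- have [-> _] := pole_integral_outside K0 (r0 j) (hr j) n.
  have [_ ->] := pole_integral_inside K0 (hr j) n.
  rewrite KE (_ : (_ <= 0) = false)// muln0 addn0 (_ : n.+1%:Z - 1 = n%:Z); last by lia.
  by rewrite mulr0 addr0 /=; field.
- rewrite NegzE; have [_ ->] := pole_integral_outside K0 (r0 j) (hr j) n.+1.
  have [-> _] := pole_integral_inside K0 (hr j) n.+1.
  rewrite KE (_ : (_ <= 0) = true)// muln1 exprD mulr0 add0r.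
  rewrite (_ : absz (- n.+1%:Z - 1) = n.+2); last by lia.
  by move: (r j ^+ (2 * p - 2)) (r j ^+ n.+2) nr => y w nr; field; rewrite nr nP.
Qed.
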